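(* Let $F$ be an algebraically closed field and let $A$ be a symmetric local $F$-algebra. If $\dim A \leq 16$ holds, then $\operatorname{soc}(Z(A))$ is an ideal in $A$.
   Context: All $F$-algebras are finite-dimensional, associative and unitary. ''Ideal'' means two-sided ideal. $Z(A)$ is the center of $A$ and $\operatorname{soc}(Z(A))$ is the socle of the commutative algebra $Z(A)$, i.e. the sum of all simple ideals of $Z(A)$; equivalently, the annihilator of $J(Z(A))$ in $Z(A)$, where $J$ denotes the Jacobson radical. An $F$-algebra $A$ is symmetric if it admits a non-degenerate, associative (i.e. $\beta(ab,c)=\beta(a,bc)$), symmetric bilinear form $\beta\colon A\times A\to F$. $A$ is local if $A/J(A)$ is a division ring (equivalently $A/J(A)\cong F$, as $F$ is algebraically closed). *)

(* Defs.v *)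
From HB Require Import structures.
From mathcomp Require Import all_boot all_order all_algebra all_field.

Set Implicit Arguments.
Unset Strict Implicit.
Unset Printing Implicit Defensive.

Import GRing.Theory.
Local Open Scope ring_scope.

Section Algebras.

Variables (F : fieldType) (A : falgType F).

Definition symmetric_algebra : Prop :=
  exists beta : {symmetric A},
    nondegenerate beta /\ forall a b c : A, beta (a * b) c = beta a (b * c).

(* Here and below, ideals are taken in {vspace A}: ideals of a unital
   subalgebra (one containing 1) are automatically linear subspaces. *)
Definition left_ideal (I : {vspace A}) : bool := ({:A} * I <= I)%VS.

Definition maximal_left_ideal (M : {vspace A}) : Prop :=
  [/\ left_ideal M, M != {:A}%VS
    & forall N : {vspace A},
        left_ideal N -> (M <= N)%VS -> N = M \/ N = {:A}%VS].

Definition jacobson (a : A) : Prop :=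
  forall M : {vspace A}, maximal_left_ideal M -> a \in M.

(* A / J(A) is a division ring, written on representatives: it is nonzero and
   every nonzero class has a two-sided inverse class. *)
Definition local_algebra : Prop :=
  ~ jacobson 1 /\
  forall a : A, ~ jacobson a ->
    exists b : A, jacobson (a * b - 1) /\ jacobson (b * a - 1).

(* Two-sided ideals of a subalgebra K of A (with 1 \in K). *)
Definition ideal_of (K I : {vspace A}) : bool :=
  [&& I <= K, K * I <= I & I * K <= I]%VS.

Definition simple_ideal_of (K I : {vspace A}) : Prop :=
  [/\ ideal_of K I, I != 0%VS
    & forall N : {vspace A},
        ideal_of K N -> (N <= I)%VS -> N = 0%VS \/ N = I].

(* The sum of all simple ideals of K, which may form an infinite family:
   an element lies in it iff it lies in the sum of finitely many of them. *)
Definition in_soc (K : {vspace A}) (x : A) : Prop :=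
  exists s : seq {vspace A},
    (forall I, I \in s -> simple_ideal_of K I) /\
    x \in (\sum_(I <- s) I)%VS.

End Algebras.

(* Main.v *)
(* Let t be a symmetrizing trace form, J the radical, Z the center and K the
   span of the commutators, so that K is the orthogonal of Z; let S be the
   annihilator of J(Z) in Z, i.e. the socle of Z. It is an ideal of A as soon
   as S K = 0. Suppose z in S and z K <> 0. Then C = A / Ann(z), with the trace
   form t(z -), is again symmetric and local, and it is not commutative; this
   forces dim C >= 8. Since z z = 0 we have z A <= Ann(z), so dim A >= 2 dim C.
   Hence dim A = 16, dim C = 8 and Ann(z) = z A, which contains J(Z).

   In a noncommutative symmetric local algebra of dimension 8 the dimensions of
   J, J^2, J^3, J^4 are 7, 4, 1, 0 or 7, 5, 3, 1; in the second case there are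
   generators x, y whose squares lie in J^3. Taking orthogonals, J(Z) <= z A
   gives z A <= J^2 and z A <= K + soc(A). Both cases are then contradictory.
   - Three generators x_i: J^2/J^3 has a basis b_i dual to the x_i for t(z -),
     and cyclic invariance of t makes all x_i b_i congruent to each other and
     all other x_i b_j congruent to 0 modulo z J; thus J^3 is too small.
   - Two generators x, y: alternating words span each J^n/J^(n+1), the
     characteristic must be 2, and after a change of generators x^2 and y^2 lie
     in z A. Then x y + y x can be corrected by an element of z A to an element
     of J(Z), which does not lie in z A. *)

Require Import Defs.
From HB Require Import structures.
From mathcomp Require Import all_boot all_order all_algebra all_field.
From mathcomp Require Import ring zify.
From Stdlib Require Import Classical_Prop.

Set Implicit Arguments.
Unset Strict Implicit.
Unset Printing Implicit Defensive.

Import GRing.Theory.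

(** The bound dim C >= 8 splits as 5 + 3. If Z has codimension at most 2, all commutators lie on one
    line; the orthogonal of that line is central, so Z has codimension at most 1 and the algebra is
    commutative. Moreover Z contains F and the orthogonal of J^2, which gives dim Z >= 5 unless J
    needs only two generators; there dim Z = 4 would make one commutator span J^2 modulo J^3, and
    such an algebra is commutative. In dimension 16 counting alone gives no contradiction. There
    Ann(z) = z A is its own orthogonal, and the powers of J are compared with those of the radical
    of C through J^n + Ann(z), whose dimension exceeds that of the power in C by exactly 8.
    Algebraic closure enters twice: in A = F + J and in solving a monic quadratic equation. The core
    is therefore stated over any field, for a trace form t and a nilpotent ideal J with F + J =
    A. *)

Section LinearAlgebra.

Local Open Scope ring_scope.

Variables (F : fieldType) (V : vectType F).
Implicit Types U W : {vspace V}.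

Lemma memv_addline (U : {vspace V}) x w :
  reflect (exists k, w - k *: x \in U) (w \in <[x]> + U)%VS.
Proof.
apply: (iffP idP) => [/memv_addP[_ /vlineP[k ->] [u Uu ->]]|[k Uw]].
  by exists k; rewrite addrAC subrr add0r.
by rewrite -[w](subrK (k *: x)) addrC memv_add // memvZ // memv_line.
Qed.

Lemma dim_addline_le x U : (\dim (<[x]> + U) <= (\dim U).+1)%N.
Proof.
rewrite (leq_trans (dimv_add_leqif _ _)) // -add1n leq_add2r dim_vline.
by case: (x != 0).
Qed.

Lemma dim_addline x U : x \notin U -> \dim (<[x]> + U)%VS = (\dim U).+1.
Proof.
move=> xU; apply/eqP; rewrite eqn_leq dim_addline_le ltnNge; apply/negP => le_d.
case/negP: xU; rewrite memvE (subv_trans (addvSl _ U)) //.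
by rewrite -(geq_leqif (dimv_leqif_sup (addvSr <[x]> U))).
Qed.

Lemma memv_dim_lt U W : (\dim W < \dim U)%N -> exists2 x, x \in U & x \notin W.
Proof.
move=> lt_d; apply/subvPn; apply: contraTN lt_d => /dimvS.
by rewrite -leqNgt.
Qed.

Lemma addline_full x U W : x \in W -> x \notin U -> (U <= W)%VS ->
  (\dim W <= (\dim U).+1)%N -> W = (<[x]> + U)%VS.
Proof.
move=> Wx Ux sUW le_d; apply/esym/eqP.
by rewrite eqEdim subv_add sUW -memvE Wx dim_addline.
Qed.

Lemma addline_exists U W : (\dim W <= (\dim U).+1)%N -> (U <= W)%VS ->
  exists2 x, x \in W & (W <= <[x]> + U)%VS.
Proof.
move=> le_d sUW; have [le_WU | /memv_dim_lt[x Wx Ux]] := leqP (\dim W) (\dim U).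
  exists 0; rewrite ?mem0v // (subv_trans _ (addvSr _ _)) //.
  by rewrite -(geq_leqif (dimv_leqif_sup sUW)).
by exists x => //; rewrite {1}(addline_full Wx Ux sUW le_d).
Qed.

(** Serves [alg_expand]: an identity in the noncommutative algebra is expanded into monomials, and
    an arbitrary linear form turns it into an identity of scalars, in which [ring] treats the value
    at each monomial as an atom. *)
Lemma scalar_ext (a b : V) : (forall f : {scalar V}, f a = f b) -> a = b.
Proof.
move=> fab; rewrite (coord_vbasis (memvf a)) (coord_vbasis (memvf b)).
by apply: eq_bigr => i _; rewrite (fab (coord (vbasis fullv) i)).
Qed.

End LinearAlgebra.

Ltac lin_expand :=
  repeat progress rewrite ?expr2 ?(mulrDl, mulrDr, mulNr, mulrN, scalerDr, scalerN)
    -?scalerAl -?scalerAr ?(mul1r, mulr1, mulrA);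
  rewrite ?(linearD, linearN, linearZ, linear0) /=.
Ltac alg_expand := apply: scalar_ext => ?; lin_expand; ring.
(** Expects [e] to have right-hand side 0: after expansion, the difference of the two sides of the
    goal is the left-hand side of [e]. *)
Ltac t_from e :=
  move: e; lin_expand; let e' := fresh in
  move=> e'; apply/subr0_eq; rewrite -[RHS]e'; ring.
(* [lia] does not identify the several inheritance paths from [falgType] to
   [vectType] that occur implicitly in dimensions. *)
Ltac dim_lia :=
  repeat match goal with
  | H : is_true (leq _ _) |- _ => revert H
  | H : @eq ?T _ _ |- _ => unify T nat; revert H
  end;
  repeat match goal with |- context [@dimv ?K ?V ?U] => move: (@dimv K V U) end;
  clear; lia.
Ltac memv_lin :=
  repeat first [assumption | apply: memvB | apply: memvD | apply: memvZ].

(** * Symmetric local algebras *)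

Section SymLocal.

Local Open Scope ring_scope.

Variables (F : fieldType) (A : falgType F) (t : {scalar A}).

(** Makes the orthogonal of [U] the kernel of a linear map, so that its dimension comes from
    rank-nullity. *)
Definition perp_map (U : {vspace A}) (a : A) : 'rV[F]_(\dim U) :=
  \row_i t (a * (vbasis U)`_i).

Fact perp_map_linear U : linear (perp_map U).
Proof.
by move=> k a b; apply/rowP => i; rewrite !mxE mulrDl -scalerAl linearP.
Qed.

HB.instance Definition _ U :=
  GRing.isLinear.Build F A 'rV[F]_(\dim U) _ (perp_map U) (perp_map_linear U).

Definition perp (U : {vspace A}) : {vspace A} := lker (linfun (perp_map U)).

Lemma perpP (U : {vspace A}) a :
  reflect (forall u, u \in U -> t (a * u) = 0) (a \in perp U).
Proof.
rewrite memv_ker lfunE /=; apply: (iffP eqP) => [a0 u /coord_vbasis->|a0].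
  rewrite mulr_sumr linear_sum big1 // => i _; rewrite -scalerAr linearZ /=.
  by have /rowP/(_ i) := a0; rewrite !mxE => ->; rewrite mulr0.
by apply/rowP => i; rewrite !mxE a0 // vbasis_mem // mem_nth // size_tuple.
Qed.

Lemma perpPn (U : {vspace A}) a :
  a \notin perp U -> exists2 u, u \in U & t (a * u) != 0.
Proof.
rewrite memv_ker lfunE /= => /rV0Pn[i]; rewrite mxE => nz.
by exists (vbasis U)`_i => //; rewrite vbasis_mem // mem_nth // size_tuple.
Qed.

Lemma sub_perp (U W : {vspace A}) : (U <= W -> perp W <= perp U)%VS.
Proof.
by move=> /subvP sUW; apply/subvP => a /perpP a0; apply/perpP => u /sUW/a0.
Qed.

Definition commutative_alg := forall a b : A, a * b = b * a.

(** The bilinear form is encoded by its trace form, as (a, b) |-> t (a * b). The last three clauses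
    replace the radical by a nilpotent ideal with residue field F. *)
Definition sym_local (J : {vspace A}) : Prop :=
  [/\ forall a b : A, t (a * b) = t (b * a),
      forall a : A, (forall b : A, t (a * b) = 0) -> a = 0,
      ideal_of {:A} J, (1 + J)%VS = {:A}%VS & exists n, (J ^+ n)%VS = 0%VS].

Variable J : {vspace A}.
Hypothesis AJ : sym_local J.

Local Notation Z := 'Z({:A})%VS.

Lemma tC (a b : A) : t (a * b) = t (b * a). Proof. by case: AJ. Qed.

Lemma t_nondeg (a : A) : (forall b : A, t (a * b) = 0) -> a = 0.
Proof. by case: AJ => _ nd _ _ _; apply: nd. Qed.

Lemma t_ext (a b : A) : (forall w : A, t (a * w) = t (b * w)) -> a = b.
Proof.
move=> ab; apply/eqP; rewrite -subr_eq0; apply/eqP/t_nondeg => w.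
by rewrite mulrBl linearB /= ab subrr.
Qed.

Lemma perp_sym (U : {vspace A}) a u : a \in perp U -> u \in U -> t (u * a) = 0.
Proof. by rewrite tC => /perpP; apply. Qed.

Lemma perp_full : perp fullv = 0%VS.
Proof.
apply/eqP; rewrite -subv0; apply/subvP => a /perpP a0.
by rewrite memv0; apply/eqP/t_nondeg => b; rewrite a0 ?memvf.
Qed.

Lemma dim_perp_ge (U : {vspace A}) : (\dim {:A} <= \dim U + \dim (perp U))%N.
Proof.
rewrite -(limg_ker_dim (linfun (perp_map U)) fullv) capfv addnC leq_add2r.
by rewrite (leq_trans (dimvS (subvf _))) // dimvf dim_matrix [(1 * _)%R]mul1n.
Qed.

Lemma dim_sep (U W : {vspace A}) :
    (forall u, u \in U -> (forall w, w \in W -> t (u * w) = 0) -> u = 0) ->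
  (\dim U <= \dim W)%N.
Proof.
move=> sep; rewrite -(@limg_dim_eq _ _ _ (linfun (perp_map W)) U).
  by rewrite (leq_trans (dimvS (subvf _))) // dimvf dim_matrix [(1 * _)%R]mul1n.
apply/eqP; rewrite -subv0; apply/subvP => u /memv_capP[Uu u0].
by rewrite memv0; apply/eqP/sep => // w; apply/perpP.
Qed.

Lemma dim_perp (U : {vspace A}) : (\dim U + \dim (perp U))%N = \dim {:A}.
Proof.
apply/eqP; rewrite eqn_leq dim_perp_ge andbT.
suffices: (\dim U <= \dim (perp U)^C)%N.
  by rewrite dimv_compl leq_subRL ?dimvS ?subvf // addnC.
apply: dim_sep => u Uu u0; apply: t_nondeg => b.
have: b \in (perp U + (perp U)^C)%VS by rewrite addv_complf memvf.
case/memv_addP=> [p Pp [q Qq ->]].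
by rewrite mulrDr linearD /= (perp_sym Pp Uu) u0 // addr0.
Qed.

Lemma perpK (U : {vspace A}) : perp (perp U) = U.
Proof.
apply/esym/eqP; rewrite eqEdim; apply/andP; split.
  by apply/subvP => u Uu; apply/perpP => p Pp; apply: perp_sym Pp Uu.
have := dim_perp (perp U); have := dim_perp U; lia.
Qed.

Lemma perp_separates (W : {vspace A}) q :
  q \notin W -> exists2 p, p \in perp W & t (p * q) = 1.
Proof.
rewrite -{1}[W]perpK => /perpPn[p Wp nz].
exists ((t (q * p))^-1 *: p); first by rewrite memvZ.
by rewrite -scalerAl linearZ /= [t (p * q)]tC mulVf.
Qed.

Lemma perpD (U W : {vspace A}) : perp (U + W) = (perp U :&: perp W)%VS.
Proof.
apply/eqP; rewrite eqEsubv subv_cap !sub_perp ?addvSl ?addvSr //=.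
apply/subvP => a /memv_capP[/perpP aU /perpP aW].
apply/perpP => _ /memv_addP[u Uu [w Ww ->]].
by rewrite mulrDr linearD /= aU ?aW // addr0.
Qed.

Lemma centerP z : reflect (forall a : A, z * a = a * z) (z \in Z).
Proof.
apply: (iffP memv_capP) => [[_ /centvP zC] a|zC]; first by rewrite zC ?memvf.
by split; [rewrite memvf | apply/centvP => a _].
Qed.

Lemma J_mull a j : j \in J -> a * j \in J.
Proof.
by case: AJ => _ _ /and3P[_ /prodvP Jl _] _ _ Jj; rewrite Jl ?memvf.
Qed.

Lemma J_mulr a j : j \in J -> j * a \in J.
Proof.
by case: AJ => _ _ /and3P[_ _ /prodvP Jr] _ _ Jj; rewrite Jr ?memvf.
Qed.

Lemma Jpow_mull n a b : b \in (J ^+ n.+1)%VS -> a * b \in (J ^+ n.+1)%VS.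
Proof.
move=> Jb; have: (fullv * J ^+ n.+1 <= J ^+ n.+1)%VS.
  rewrite expvSl prodvA prodvSl //.
  by apply/prodvP => u v _; apply: J_mull.
by move/prodvP; apply; rewrite ?memvf.
Qed.

Lemma Jpow_mulr n a b : b \in (J ^+ n.+1)%VS -> b * a \in (J ^+ n.+1)%VS.
Proof.
move=> Jb; have: (J ^+ n.+1 * fullv <= J ^+ n.+1)%VS.
  rewrite expvSr -prodvA prodvSr //.
  by apply/prodvP => u v Ju _; apply: J_mulr.
by move/prodvP; apply; rewrite ?memvf.
Qed.

Lemma Jpow_mul m n a b :
  a \in (J ^+ m)%VS -> b \in (J ^+ n)%VS -> a * b \in (J ^+ (m + n))%VS.
Proof. by rewrite expvD; apply: memv_mul. Qed.

Lemma Jpow_sub m n : (0 < m <= n)%N -> (J ^+ n <= J ^+ m)%VS.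
Proof.
case: m => // m /subnKC <-; elim: (n - m.+1)%N => [|k IHk]; first by rewrite addn0.
rewrite addnS; apply: subv_trans IHk; rewrite expvSl addSn.
by apply/prodvP => a b _; apply: Jpow_mull.
Qed.

Lemma Jpow_mem m n a : a \in (J ^+ n)%VS -> (0 < m <= n)%N -> a \in (J ^+ m)%VS.
Proof. by move=> Ja /Jpow_sub/subvP; apply. Qed.

Lemma Jpow_stable n : (J ^+ n <= J ^+ n.+1)%VS -> (J ^+ n)%VS = 0%VS.
Proof.
move=> sJ; have sJk k: (J ^+ n <= J ^+ (n + k))%VS.
  elim: k => [|k IHk]; first by rewrite addn0.
  by rewrite (subv_trans sJ) // addnS !expvSl prodvSr.
case: AJ => _ _ _ _ [k Jk0]; apply/eqP; rewrite -subv0.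
by apply: subv_trans (sJk k) _; rewrite addnC expvD Jk0 prod0v subvv.
Qed.

Lemma Jpow_dim n : (0 < n)%N -> (J ^+ n)%VS != 0%VS ->
  (\dim (J ^+ n.+1) < \dim (J ^+ n))%N.
Proof.
move=> n0 Jn0; rewrite (ltn_leqif (dimv_leqif_sup (Jpow_sub _))).
  by apply: contra Jn0 => /Jpow_stable->.
by rewrite n0 leqnSn.
Qed.

Lemma J_decomp a : exists k, a - k%:A \in J.
Proof.
case: AJ => _ _ _ defA _; have: a \in (1 + J)%VS by rewrite defA memvf.
by case/memv_addline=> k; exists k.
Qed.

Lemma J1 : 1 \notin J.
Proof.
apply/negP => J1; case: AJ => _ _ _ _ [n Jn0].
have: 1 \in (J ^+ n)%VS.
  elim: n {Jn0} => [|n IHn]; first exact: memv_line.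
  by rewrite expvSl -[1]mulr1 memv_mul.
by rewrite Jn0 memv0 oner_eq0.
Qed.

Lemma dim_J : \dim {:A} = (\dim J).+1.
Proof. by case: AJ => _ _ _ <- _; rewrite dim_addline ?J1. Qed.

Lemma comm_J2 (a b : A) : a * b - b * a \in (J ^+ 2)%VS.
Proof.
have [k Ja] := J_decomp a; have [l Jb] := J_decomp b.
have ->: a * b - b * a = (a - k%:A) * (b - l%:A) - (b - l%:A) * (a - k%:A).
  by alg_expand.
by rewrite memvB // expv2 memv_mul.
Qed.

Lemma comm_perp_center (a b : A) : a * b - b * a \in perp Z.
Proof.
apply/perpP => z /centerP zC.
by rewrite mulrBl linearB /= -!mulrA -[b * z]zC [a * (z * b)]mulrA [t (a * z * b)]tC subrr.
Qed.

(** By cyclicity, t ((a w - w a) p) = t ((p a - a p) w), and nondegeneracy applies as w varies. *)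
Lemma perp_center (U : {vspace A}) :
  (forall a b : A, a * b - b * a \in U) -> (perp U <= Z)%VS.
Proof.
move=> cU; apply/subvP => p Up; apply/centerP => a; apply: t_ext => w.
have := perp_sym Up (cU a w); rewrite mulrBl linearB /= => /eqP.
rewrite subr_eq0 => /eqP; rewrite [t (a * w * p)]tC !mulrA => ->.
by rewrite -[w * a * p]mulrA [t (w * _)]tC.
Qed.

Lemma perpZ_sub (U : {vspace A}) :
  (forall a b : A, a * b - b * a \in U) -> (perp Z <= U)%VS.
Proof. by move=> /perp_center/sub_perp; rewrite perpK. Qed.

Lemma t_prod0 p (U W : {vspace A}) :
    (forall u w, u \in U -> w \in W -> t (p * (u * w)) = 0) ->
  forall b, b \in (U * W)%VS -> t (p * b) = 0.
Proof.
move=> p0 b; have: (U * W <= perp <[p]>)%VS.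
  apply/prodvP => u w Uu Ww; apply/perpP => _ /vlineP[k ->].
  by rewrite -scalerAr linearZ /= tC p0 // mulr0.
by move/subvP=> sW /sW/perpP; rewrite tC; apply; apply: memv_line.
Qed.

Lemma perp_Jpow_mulr n p b :
  p \in perp (J ^+ n.+1) -> b \in (J ^+ n.+1)%VS -> p * b = 0.
Proof.
move=> /perpP p0 Jb; apply: t_nondeg => w.
by rewrite -mulrA p0 // Jpow_mulr.
Qed.

Lemma perp_Jpow_mull n p b :
  p \in perp (J ^+ n.+1) -> b \in (J ^+ n.+1)%VS -> b * p = 0.
Proof.
move=> p0 Jb; apply: t_nondeg => w.
by rewrite -mulrA tC -mulrA; move/perpP: p0; apply; apply: Jpow_mull.
Qed.

Lemma Jpow_sub_perp m n : (J ^+ (m + n) = 0)%VS -> (J ^+ m <= perp (J ^+ n))%VS.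
Proof.
move=> J0; apply/subvP => a Ja; apply/perpP => b Jb.
have := Jpow_mul Ja Jb; rewrite J0 memv0 => /eqP->; exact: linear0.
Qed.

Lemma Jpow_perp0 m n : (J ^+ m <= perp (J ^+ n.+1))%VS -> (J ^+ (m + n.+1) = 0)%VS.
Proof.
move=> /subvP sJ; apply/eqP; rewrite -subv0 expvD; apply/prodvP => a b Ja Jb.
by rewrite (perp_Jpow_mulr (sJ a Ja) Jb) mem0v.
Qed.

Lemma dim_soc : \dim (perp J) = 1%N.
Proof. have := dim_perp J; rewrite dim_J; lia. Qed.

Lemma Jpow_soc n : (J ^+ n.+1)%VS = 0%VS -> (J ^+ n <= perp J)%VS.
Proof. by move=> J0; rewrite -(expv1 J) Jpow_sub_perp ?addn1. Qed.

(** The last nonzero power of J lies in the line [perp J], hence equals it, and every nonzero power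
    contains the last one. *)
Lemma soc_sub_Jpow n : (0 < n)%N -> (J ^+ n)%VS != 0%VS -> (perp J <= J ^+ n)%VS.
Proof.
move=> n0 Jn; case: AJ => _ _ _ _ exk0.
have exk: exists k, (J ^+ k == 0)%VS by have [k Jk] := exk0; exists k; apply/eqP.
case: (ex_minnP exk) => -[|k] Jk mink.
  by move: (vspace1_neq0 A); rewrite -(expv0 J) Jk.
have le_nk: (n <= k)%N.
  rewrite leqNgt; apply: contra Jn => lt_kn.
  by rewrite -subv0 -(eqP Jk) Jpow_sub.
have Jk0: (J ^+ k)%VS != 0%VS by apply/negP => /mink; rewrite ltnn.
apply: subv_trans (Jpow_sub _); last by rewrite n0; apply: le_nk.
rewrite -(geq_leqif (dimv_leqif_sup (Jpow_soc (eqP Jk)))) dim_soc.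
by rewrite lt0n dimv_eq0.
Qed.

Lemma Jpow_soc_eq n : (0 < n)%N -> \dim (J ^+ n) = 1%N -> (J ^+ n)%VS = perp J.
Proof.
move=> n0 d1; apply/esym/eqP; rewrite eqEdim d1 dim_soc soc_sub_Jpow //.
by rewrite -dimv_eq0 d1.
Qed.

Lemma Jpow_dim1 n : (0 < n)%N -> (\dim (J ^+ n) <= 1)%N -> (J ^+ n.+1)%VS = 0%VS.
Proof.
move=> n0 d1; have [J0|nz] := eqVneq (J ^+ n)%VS 0%VS.
  by rewrite expvSr J0 prod0v.
by apply/eqP; rewrite -dimv_eq0 -leqn0 -ltnS (leq_trans (Jpow_dim n0 nz)).
Qed.

Lemma soc2_center : (perp (J ^+ 2) <= Z)%VS.
Proof. exact/perp_center/comm_J2. Qed.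

Lemma perpZ_J2 : (perp Z <= J ^+ 2)%VS.
Proof. exact/perpZ_sub/comm_J2. Qed.

Lemma memv1Z : 1 \in Z.
Proof. by apply/centerP => a; rewrite mul1r mulr1. Qed.

(** Dual to Z + J = A, which holds because Z contains the scalars. *)
Lemma perpZ_cap_soc : (perp Z :&: perp J = 0)%VS.
Proof.
rewrite -perpD; suffices ->: (Z + J = {:A})%VS by apply: perp_full.
have sZJ: (1 + J <= Z + J)%VS by rewrite addvS // -memvE memv1Z.
by apply/eqP; rewrite eqEsubv subvf; case: AJ sZJ => _ _ _ -> _ ->.
Qed.

Lemma Jpow_descent (U : {vspace A}) m :
  (forall n, (m <= n)%N -> (J ^+ n <= U + J ^+ n.+1)%VS) -> (J ^+ m <= U)%VS.
Proof.
move=> sJ; have sUk k: (J ^+ m <= U + J ^+ (m + k))%VS.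
  elim: k => [|k IHk]; first by rewrite addn0 addvSr.
  rewrite (subv_trans IHk) // subv_add addvSl /= addnS sJ // leq_addr //.
case: AJ => _ _ _ _ [k Jk0]; apply: subv_trans (sUk k) _.
by rewrite addnC expvD Jk0 prod0v addv0.
Qed.

(** With U0 = U :&: J, the hypothesis propagates to J^n <= U0^n + J^(n+1) for all n >= 1, and
    nilpotency ends the descent inside U. *)
Lemma generated (U : {aspace A}) :
  1 \in U -> (J <= U + J ^+ 2)%VS -> U = {:A}%VS :> {vspace A}.
Proof.
move=> U1 sJ; pose U0 := (U :&: J)%VS.
have sJ0: (J <= U0 + J ^+ 2)%VS.
  apply/subvP => j Jj; have /memv_addP[u Uu [r Jr def_j]] := subvP sJ j Jj.
  rewrite def_j memv_add // memv_cap Uu -(addrK r u) -def_j memvB //.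
  exact: (@Jpow_mem 1 2).
have sJn n: (J ^+ n.+1 <= U0 ^+ n.+1 + J ^+ n.+2)%VS.
  elim: n => [|n IHn]; first by rewrite !expv1.
  rewrite expvSl; apply/prodvP => a b Ja Jb.
  have /memv_addP[u Uu [r Jr ->]] := subvP sJ0 a Ja.
  have /memv_addP[u' Uu' [r' Jr' def_b]] := subvP IHn b Jb.
  rewrite mulrDl {1}def_b mulrDr -addrA memv_add //.
    by rewrite expvSl memv_mul.
  rewrite memvD //; first by rewrite expvSl memv_mul //; case/memv_capP: Uu.
  by rewrite -[n.+3]/(2 + n.+1)%N expvD memv_mul.
have sU0 n: (U0 ^+ n.+1 <= U)%VS.
  elim: n => [|n IHn]; first by rewrite expv1 capvSl.
  by rewrite expvSl prodv_sub // capvSl.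
have sJU: (J <= U)%VS.
  rewrite -[J]expv1; apply: Jpow_descent => -[|n] // _.
  by apply: subv_trans (sJn n) _; rewrite addvS.
have sU: (1 + J <= U)%VS by rewrite subv_add sJU -memvE U1.
by apply/eqP; rewrite eqEsubv subvf; case: AJ sU => _ _ _ -> _ ->.
Qed.

Lemma center_gen (U : {vspace A}) v : (J <= U + J ^+ 2)%VS ->
  (forall u, u \in U -> v * u = u * v) -> v \in Z.
Proof.
move=> sJ vC; apply/centerP => a.
have: a \in 'C[v]%VS; last by move/cent1vP->.
rewrite (generated (cent1v1 v)) ?memvf // (subv_trans sJ) // addvS //.
by apply/subvP => u Uu; apply/cent1vP; rewrite vC.
Qed.

Lemma comm_addZ u v a b : u \in Z -> v \in Z ->
  (u + a) * (v + b) - (v + b) * (u + a) = a * b - b * a.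
Proof.
move=> /centerP uC /centerP vC.
by rewrite !(mulrDl, mulrDr) !uC [v * a]vC; alg_expand.
Qed.

(** * Criteria for commutativity *)

Lemma commutative_codim1 : (\dim {:A} <= (\dim Z).+1)%N -> commutative_alg.
Proof.
move=> le_d; have [a _ defA] := addline_exists le_d (subvf Z).
move=> b c; have /memv_addline[k Zb] := subvP defA b (memvf b).
have /memv_addline[l Zc] := subvP defA c (memvf c).
apply/eqP; rewrite -subr_eq0 -[b](subrK (k *: a)) -[c](subrK (l *: a)).
by rewrite comm_addZ // -!(scalerAl, scalerAr) !scalerA mulrC subrr.
Qed.

(** The orthogonal of the line is central and has codimension at most one. *)
Lemma commutative_line c :
  (forall a b : A, a * b - b * a \in <[c]>%VS) -> commutative_alg.
Proof.
move=> /perp_center/dimvS sZ; apply: commutative_codim1.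
have := dim_perp <[c]>%VS; rewrite dim_vline; lia.
Qed.

(** Two elements a, b span A modulo Z, so every commutator is a multiple of a b - b a and
    [commutative_line] applies. *)
Lemma commutative_codim2 : (\dim {:A} <= (\dim Z).+2)%N -> commutative_alg.
Proof.
move=> le_d; have [le_d1|lt_d] := leqP (\dim {:A}) (\dim Z).+1.
  exact: commutative_codim1.
have [a _ Za] := memv_dim_lt (ltnW lt_d).
have le_d' : (\dim {:A} <= (\dim (<[a]> + Z)).+1)%N by rewrite dim_addline.
have [b _ defA] := addline_exists le_d' (subvf _).
apply: (@commutative_line (a * b - b * a)) => u v.
have /memv_addline[k1 /memv_addline[k2]] := subvP defA u (memvf u).
set u' := _ - _ => Zu; have ->: u = u' + k2 *: a + k1 *: b by rewrite !subrK.
have /memv_addline[l1 /memv_addline[l2]] := subvP defA v (memvf v).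
set v' := (_ - _) => Zv; have ->: v = v' + l2 *: a + l1 *: b by rewrite !subrK.
apply/vlineP; exists (k2 * l1 - k1 * l2).
move: (u') (v') Zu Zv => p q Zp Zq.
by rewrite -!addrA comm_addZ //; alg_expand.
Qed.

Lemma Jpow2_mul a b : a \in J -> b \in J -> a * b \in (J ^+ 2)%VS.
Proof. by rewrite expv2; apply: memv_mul. Qed.

Lemma JpowS_mull n a b : a \in J -> b \in (J ^+ n)%VS -> a * b \in (J ^+ n.+1)%VS.
Proof. by rewrite expvSl; apply: memv_mul. Qed.

Lemma JpowS_mulr n a b : a \in (J ^+ n)%VS -> b \in J -> a * b \in (J ^+ n.+1)%VS.
Proof. by rewrite expvSr; apply: memv_mul. Qed.

Lemma J_of_Jpow n a : a \in (J ^+ n.+1)%VS -> a \in J.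
Proof. by move=> Ja; have /(_ isT) := @Jpow_mem 1 n.+1 a Ja; rewrite expv1. Qed.

Lemma perp_coef (W : {vspace A}) p q b :
  p \in perp W -> t (p * q) = 1 -> b \in (<[q]> + W)%VS -> b - t (p * b) *: q \in W.
Proof.
move=> /perpP p0 pq /memv_addline[k Wb]; suffices ->: t (p * b) = k by [].
have := p0 _ Wb; rewrite mulrBr linearB /= -scalerAr linearZ /= pq mulr1.
by move/eqP; rewrite subr_eq0 => /eqP.
Qed.

(* If [J^2/J^3] is a line, both sides of [(uv)w = u(vw)] modulo [J^4] have
   rank one in [(u, v, w)], which makes the product [J/J^2 x J/J^2 -> J^2/J^3]
   the square of a linear form. *)
Lemma line_J2_rank1 q :
    q \notin (J ^+ 3)%VS -> (J ^+ 2 <= <[q]> + J ^+ 3)%VS ->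
    (J ^+ 3)%VS != 0%VS ->
  exists p s k, [/\ p \in perp (J ^+ 3), t (p * q) = 1
    & forall u v, u \in J -> v \in J -> t (p * (u * v)) = k * t (s * u) * t (s * v)].
Proof.
move=> J3q sJ2 nzJ3; have [p Pp pq] := perp_separates J3q.
have [r J3r J4r]: exists2 r, r \in (J ^+ 3)%VS & r \notin (J ^+ 4)%VS.
  by apply/subvPn; apply: contra nzJ3 => /Jpow_stable->.
have [p' Pp' pr] := perp_separates J4r.
have p'0 b : b \in (J ^+ 4)%VS -> t (p' * b) = 0 by move/perpP: Pp'; apply.
have Jcoef b : b \in (J ^+ 2)%VS -> b - t (p * b) *: q \in (J ^+ 3)%VS.
  by move=> /(subvP sJ2); apply: perp_coef.
have mf b w : b \in (J ^+ 2)%VS -> w \in J ->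
    t (p' * (b * w)) = t (p * b) * t (p' * q * w).
  by move=> Jb Jw; have e := p'0 _ (JpowS_mulr (Jcoef b Jb) Jw); t_from e.
have gm u b : u \in J -> b \in (J ^+ 2)%VS ->
    t (p' * (u * b)) = t (q * p' * u) * t (p * b).
  move=> Ju Jb; have e := p'0 _ (JpowS_mull Ju (Jcoef b Jb)).
  by rewrite -[q * p' * u]mulrA [t (q * _)]tC; t_from e.
have E u v w : u \in J -> v \in J -> w \in J ->
    t (p * (u * v)) * t (p' * q * w) = t (q * p' * u) * t (p * (v * w)).
  by move=> Ju Jv Jw; rewrite -mf ?Jpow2_mul // -gm ?Jpow2_mul // !mulrA.
have [/perpP p'q0|/perpPn[w Jw nz]] := boolP (p' * q \in perp J).
  suffices p'r0: t (p' * r) = 0 by move/eqP: pr; rewrite p'r0 eq_sym oner_eq0.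
  rewrite expvSr in J3r; apply: t_prod0 J3r => b w Jb Jw.
  by rewrite mf // p'q0 // mulr0.
exists p, (q * p'), (t (p * (w * w)) / t (p' * q * w) ^+ 2); split=> // u v Ju Jv.
have := E u v w Ju Jv Jw; have := E v w w Jv Jw Jw => E1 E2.
apply: (mulIf nz); rewrite {}E2; apply: (mulIf nz); rewrite -[LHS]mulrA E1.
by field.
Qed.

(** If J^3 were nonzero, [line_J2_rank1] would make the product symmetric modulo J^3, so the
    commutator would have coefficient 0, while as spanning vector it has coefficient 1. *)
Lemma line_comm_J2 x y : x \in J -> y \in J ->
  (J ^+ 2 <= <[x * y - y * x]> + J ^+ 3)%VS -> (J ^+ 3)%VS = 0%VS.
Proof.
move=> Jx Jy sJ2; apply/eqP/negP => /negP nzJ3.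
have [J3c|J3c] := boolP (x * y - y * x \in (J ^+ 3)%VS).
  case/negP: nzJ3; rewrite expvSl (Jpow_stable (n := 2)) ?prodv0 //.
  by rewrite (subv_trans sJ2) // subv_add subvv andbT -memvE.
have [p [s [k [_ pq m]]]] := line_J2_rank1 J3c sJ2 nzJ3.
move/eqP: pq; rewrite mulrBr linearB /= !m // [k * _ * _]mulrAC.
by rewrite [k * t (s * y) * _]mulrAC subrr eq_sym oner_eq0.
Qed.

Lemma J_span2 x y a : (J <= <[x]> + (<[y]> + J ^+ 2))%VS -> a \in J ->
  exists k l r, r \in (J ^+ 2)%VS /\ a = k *: x + l *: y + r.
Proof.
move=> sJ /(subvP sJ)/memv_addline[k /memv_addline[l Jr]].
by exists k, l, (a - k *: x - l *: y); split=> //; rewrite [RHS]addrC addrA addrAC !subrK.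
Qed.

(* Two degenerate generators: the product on [J/J^2] is [x^2] only, hence [J^2]
   lies in [F[x]] and is central. *)
Lemma comm_line_gen2 x y q :
    x \in J -> y \in J -> (J <= <[x]> + (<[y]> + J ^+ 2))%VS ->
    (J ^+ 2 <= <[q]> + J ^+ 3)%VS ->
    x * y \in (J ^+ 3)%VS -> y * x \in (J ^+ 3)%VS -> y * y \in (J ^+ 3)%VS ->
  commutative_alg.
Proof.
move=> Jx Jy sJ sJ2 Jxy Jyx Jyy.
have J3mul a b : a \in J -> b \in J -> exists k, a * b - k *: (x * x) \in (J ^+ 3)%VS.
  move=> /(J_span2 sJ)[k [l [r [Jr ->]]]] /(J_span2 sJ)[k' [l' [r' [Jr' ->]]]].
  exists (k * k').
  have ->: (k *: x + l *: y + r) * (k' *: x + l' *: y + r') - (k * k') *: (x * x)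
    = k *: (l' *: (x * y)) + l *: (k' *: (y * x)) + l *: (l' *: (y * y))
      + (k *: x + l *: y) * r' + r * (k' *: x + l' *: y + r') by alg_expand.
  rewrite memvD ?memvD ?memvZ //.
    by rewrite JpowS_mull // memvD // memvZ.
  by rewrite JpowS_mulr // !memvD ?memvZ // (J_of_Jpow Jr').
have sJx2: (J ^+ 2 <= <[x ^+ 2]> + J ^+ 3)%VS.
  rewrite expv2; apply/prodvP => a b Ja Jb; have [k J3ab] := J3mul a b Ja Jb.
  by apply/memv_addline; exists k; rewrite expr2.
have sJx n: (J ^+ n.+2 <= <[x ^+ n.+2]> + J ^+ n.+3)%VS.
  elim: n => // n IHn; rewrite expvSl; apply/prodvP => a b.
  move=> /(J_span2 sJ)[k [l [r [Jr ->]]]] Jb.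
  have /memv_addline[m Jb'] := subvP IHn b Jb.
  apply/memv_addline; exists (k * m).
  have ->: (k *: x + l *: y + r) * b - (k * m) *: x ^+ n.+3 =
      k *: (x * (b - m *: x ^+ n.+2)) + l *: (y * (b - m *: x ^+ n.+2))
      + l *: (m *: (y * x * x ^+ n.+1)) + r * b.
    by rewrite [x ^+ n.+3]exprS [x ^+ n.+2]exprS; alg_expand.
  have Jxn: x ^+ n.+1 \in (J ^+ n.+1)%VS.
    by elim: (n) => [|i IHi]; rewrite ?expr1 ?expv1 // exprS JpowS_mull.
  apply: memvD; last by have := Jpow_mul Jr Jb.
  apply: memvD; first apply: memvD.
  - by apply: memvZ; apply: JpowS_mull.
  - by apply: memvZ; apply: JpowS_mull.
  - by do 2!apply: memvZ; have := Jpow_mul Jyx Jxn.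
have J2sub (U : {vspace A}) : (forall n, x ^+ n.+2 \in U) -> (J ^+ 2 <= U)%VS.
  move=> Ux; apply: Jpow_descent => -[|[|n]] // _.
  by rewrite (subv_trans (sJx n)) // addvS // -memvE.
have xC b : b \in (J ^+ 2)%VS -> b * x = x * b.
  by move=> /(subvP (J2sub 'C[x]%VS (fun n => cent1vX x n.+2)))/cent1vP.
have J2xy := Jpow_mem Jxy (isT : 0 < 2 <= 3)%N.
have J2yx := Jpow_mem Jyx (isT : 0 < 2 <= 3)%N.
have yxx: x * y * x = y * x * x by rewrite [RHS]xC // mulrA.
have xxy: x * x * y = x * y * x by rewrite [RHS]xC // mulrA.
have xnC n: x ^+ n.+2 * y = y * x ^+ n.+2.
  elim: n => [|n IHn]; first by rewrite expr2 mulrA -yxx -xxy.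
  by rewrite exprS -mulrA IHn exprS !mulrA yxx.
have yC b : b \in (J ^+ 2)%VS -> b * y = y * b.
  have sC: (J ^+ 2 <= 'C[y])%VS by apply: J2sub => n; apply/cent1vP.
  by move=> /(subvP sC)/cent1vP.
have sJ2Z: (J ^+ 2 <= Z)%VS.
  apply/subvP => b J2b; apply: (@center_gen (<[x]> + <[y]>)).
    by rewrite -addvA.
  move=> _ /memv_addP[_ /vlineP[k ->] [_ /vlineP[l ->] ->]].
  by rewrite mulrDl mulrDr -!scalerAl -!scalerAr xC ?yC.
apply: (@commutative_line (x * y - y * x)) => a b.
have [k] := J_decomp a; set a1 := a - _; have [l] := J_decomp b; set b1 := b - _.
have ->: a * b - b * a = a1 * b1 - b1 * a1 by rewrite /a1 /b1; alg_expand.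
move=> /(J_span2 sJ)[k1 [l1 [r1 [Jr1 ->]]]] /(J_span2 sJ)[k2 [l2 [r2 [Jr2 ->]]]].
rewrite ![_ + _ *: y + _]addrC comm_addZ ?(subvP sJ2Z) //.
by apply/vlineP; exists (l1 * k2 - k1 * l2); alg_expand.
Qed.

Lemma comm_J (U : {vspace A}) :
    (forall u v, u \in J -> v \in J -> u * v - v * u \in U) ->
  forall a b : A, a * b - b * a \in U.
Proof.
move=> cU a b; have [k Ja] := J_decomp a; have [l Jb] := J_decomp b.
suffices ->: a * b - b * a = (a - k%:A) * (b - l%:A) - (b - l%:A) * (a - k%:A).
  exact: cU.
by alg_expand.
Qed.

Lemma comm_gen2_mod (W : {vspace A}) x y :
    x \in J -> y \in J -> (J <= <[x]> + (<[y]> + J ^+ 2))%VS ->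
    (forall u b, u \in J -> b \in (J ^+ 2)%VS -> u * b - b * u \in W) ->
  forall a b : A, a * b - b * a \in (<[x * y - y * x]> + W)%VS.
Proof.
move=> Jx Jy sJ JW; apply: comm_J => u v Ju Jv.
have [k1 [l1 [r1 [Jr1 def_u]]]] := J_span2 sJ Ju.
have [k2 [l2 [r2 [Jr2 def_v]]]] := J_span2 sJ Jv.
apply/memv_addline; exists (k1 * l2 - l1 * k2).
have ->: u * v - v * u - (k1 * l2 - l1 * k2) *: (x * y - y * x)
  = ((k1 *: x + l1 *: y) * r2 - r2 * (k1 *: x + l1 *: y)) - (v * r1 - r1 * v).
  by rewrite def_u def_v; alg_expand.
apply: memvB; apply: JW => //.
by rewrite memvD ?memvZ.
Qed.

Lemma comm_gen2_J3_mod x y : x \in J -> y \in J ->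
    (J <= <[x]> + (<[y]> + J ^+ 2))%VS ->
  forall a b : A, a * b - b * a \in (<[x * y - y * x]> + J ^+ 3)%VS.
Proof.
move=> Jx Jy sJ; apply: comm_gen2_mod => // u b Ju Jb.
by apply: memvB; [apply: JpowS_mull | apply: JpowS_mulr].
Qed.

Lemma perpZ_gen2 x y : x \in J -> y \in J -> (J <= <[x]> + (<[y]> + J ^+ 2))%VS ->
  (perp Z <= <[x * y - y * x]> + J ^+ 3)%VS.
Proof. by move=> Jx Jy sJ; apply: perpZ_sub; apply: comm_gen2_J3_mod. Qed.

Lemma comm_gen2_J3 x y : x \in J -> y \in J ->
    (J <= <[x]> + (<[y]> + J ^+ 2))%VS -> (J ^+ 3)%VS = 0%VS -> commutative_alg.
Proof.
move=> Jx Jy sJ J30; apply: (@commutative_line (x * y - y * x)) => a b.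
by have := comm_gen2_J3_mod Jx Jy sJ a b; rewrite J30 addv0.
Qed.

(** By [line_J2_rank1] the product on J/J^2 is the square of a linear form. Choosing one generator
    in the kernel of this form gives the degenerate situation of [comm_line_gen2]. *)
Lemma comm_gen2 x y q :
    x \in J -> y \in J -> (J <= <[x]> + (<[y]> + J ^+ 2))%VS ->
    (J ^+ 2 <= <[q]> + J ^+ 3)%VS ->
  commutative_alg.
Proof.
move=> Jx Jy sJ sJ2; have [J30|nzJ3] := eqVneq (J ^+ 3)%VS 0%VS.
  exact: comm_gen2_J3 Jx Jy sJ J30.
have [J3q|J3q] := boolP (q \in (J ^+ 3)%VS).
  case/eqP: nzJ3; rewrite expvSl (Jpow_stable (n := 2)) ?prodv0 //.
  by rewrite (subv_trans sJ2) // subv_add subvv andbT -memvE.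
have [p [s [k [Pp pq m]]]] := line_J2_rank1 J3q sJ2 nzJ3.
have J3E u v : u \in J -> v \in J -> t (s * u) = 0 \/ t (s * v) = 0 ->
    u * v \in (J ^+ 3)%VS.
  move=> Ju Jv suv; have := perp_coef Pp pq (subvP sJ2 _ (Jpow2_mul Ju Jv)).
  by rewrite m //; case: suv => ->; rewrite ?(mulr0, mul0r) scale0r subr0.
have [sy0|nz] := eqVneq (t (s * y)) 0.
  by apply: (comm_line_gen2 Jx Jy sJ sJ2); apply: J3E; rewrite // sy0; auto.
pose z := x - (t (s * x) / t (s * y)) *: y.
have Jz: z \in J by rewrite memvB ?memvZ.
have sz: t (s * z) = 0.
  by rewrite mulrBr linearB -scalerAr linearZ /= divfK // subrr.
apply: (comm_line_gen2 Jy Jz _ sJ2); try by apply: J3E; rewrite // sz; auto.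
rewrite (subv_trans sJ) // !subv_add; apply/and3P; split.
- apply/memv_addline; exists (t (s * x) / t (s * y)).
  by rewrite (subvP (addvSl _ _)) ?memv_line.
- exact: addvSl.
- exact: subv_trans (addvSr _ _) (addvSr _ _).
Qed.

Lemma J_gen2 : (\dim J <= (\dim (J ^+ 2)).+2)%N ->
  exists x y, [/\ x \in J, y \in J & (J <= <[x]> + (<[y]> + J ^+ 2))%VS].
Proof.
move=> le_d; have sJ2: (J ^+ 2 <= J)%VS by rewrite -{2}[J]expv1 Jpow_sub.
have [y Jy le_d1]: exists2 y, y \in J & (\dim J <= (\dim (<[y]> + J ^+ 2)).+1)%N.
  have [le_d1|lt_d] := leqP (\dim J) (\dim (J ^+ 2)).+1.
    by exists 0; rewrite ?mem0v // (leq_trans le_d1) // ltnS dimvS ?addvSr.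
  by have [y Jy J2y] := memv_dim_lt (ltnW lt_d); exists y; rewrite ?dim_addline.
have [|x Jx sJ] := addline_exists le_d1; first by rewrite subv_add -memvE Jy.
by exists x, y.
Qed.

Lemma J_gen1_comm : (\dim J <= (\dim (J ^+ 2)).+1)%N -> commutative_alg.
Proof.
move=> le_d; have sJ2: (J ^+ 2 <= J)%VS by rewrite -{2}[J]expv1 Jpow_sub.
have [x Jx sJ] := addline_exists le_d sJ2.
have xZ: x \in Z.
  by apply: center_gen sJ _ => _ /vlineP[k ->]; rewrite -scalerAl -scalerAr.
move=> a b; have: a \in Z; last by move/centerP->.
apply: center_gen sJ _ => _ /vlineP[k ->].
by rewrite -scalerAl -scalerAr; move/centerP: xZ => ->.
Qed.

(* The pairing of [J] with [J^(n+2)/J^(n+3)] has rank one, so modulo its kernel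
   [u] and [v] are proportional; a factor in the kernel can be rotated away. *)
Lemma top_power_comm n u v b :
    \dim (J ^+ n.+3) = 1%N -> \dim (J ^+ n.+2) = 2%N ->
    u \in J -> v \in J -> b \in (J ^+ n.+1)%VS ->
  t ((u * v - v * u) * b) = 0.
Proof.
move=> d3 d2 Ju Jv Jb.
have perp0 u' w : u' \in perp (J ^+ n.+2) -> w \in J ->
    t ((u' * w - w * u') * b) = 0.
  move=> /perpP u0 Jw; rewrite mulrBl linearB /= -!mulrA u0 ?JpowS_mull //.
  by rewrite tC -mulrA u0 ?JpowS_mulr // subrr.
have le_d: (\dim (J ^+ n.+2) <= (\dim (J ^+ n.+3)).+1)%N by rewrite d3 d2.
have [e Je sJ] := addline_exists le_d (Jpow_sub (leqnSn n.+2 : 0 < n.+2 <= n.+3)%N).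
have perp_e w : w \in J -> t (w * e) = 0 -> w \in perp (J ^+ n.+2).
  move=> Jw we0; apply/perpP => c /(subvP sJ)/memv_addline[k J3c].
  have J4: (J ^+ n.+4)%VS = 0%VS by apply: Jpow_dim1; rewrite ?d3.
  have := JpowS_mull Jw J3c; rewrite J4 memv0 => /eqP we.
  by rewrite -[c](subrK (k *: e)) mulrDr we add0r -scalerAr linearZ /= we0 mulr0.
have [ue0|nz] := eqVneq (t (u * e)) 0; first by apply: perp0 => //; apply: perp_e.
pose k := t (v * e) / t (u * e); pose w := v - k *: u.
have Jw: w \in J by rewrite memvB ?memvZ.
have w0: t (w * e) = 0 by rewrite mulrBl linearB -scalerAl linearZ /= divfK // subrr.
have ->: u * v - v * u = - (w * u - u * w) by rewrite /w; alg_expand.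
by rewrite mulNr linearN perp0 ?oppr0 // perp_e.
Qed.

Lemma center_gen2 x y v : (J <= <[x]> + (<[y]> + J ^+ 2))%VS ->
  v * x = x * v -> v * y = y * v -> v \in Z.
Proof.
rewrite addvA => sJ vx vy; apply: center_gen sJ _.
move=> _ /memv_addP[_ /vlineP[k ->] [_ /vlineP[l ->] ->]].
by rewrite mulrDl mulrDr -!scalerAl -!scalerAr vx vy.
Qed.

Lemma comm_gens x y : (J <= <[x]> + (<[y]> + J ^+ 2))%VS ->
  x * y = y * x -> commutative_alg.
Proof.
move=> sJ xy; have /centerP xC := center_gen2 sJ erefl xy.
have /centerP yC := center_gen2 sJ (esym xy) erefl.
move=> a b; have /centerP aC: a \in Z by apply: center_gen2 sJ _ _.
exact: aC.
Qed.

(** * Dimension bounds in noncommutative symmetric local algebras *)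

Section Noncommutative.

Hypothesis ncA : ~ commutative_alg.

Lemma nc_dim_center : (\dim Z + 3 <= \dim {:A})%N.
Proof.
rewrite addn3 ltnNge; apply/negP => /commutative_codim2; exact: ncA.
Qed.

Lemma nc_J2 : (J ^+ 2)%VS != 0%VS.
Proof.
apply/eqP => J20; have := dimvS perpZ_J2; have := dim_perp Z.
rewrite J20 dimv0; have := nc_dim_center; dim_lia.
Qed.

Lemma nc_soc2_J : (perp (J ^+ 2) <= J)%VS.
Proof. by rewrite -{2}[J]perpK sub_perp // soc_sub_Jpow // nc_J2. Qed.

(** Counts the central subspace F + [perp (J ^+ 2)]; the sum is direct because [perp (J ^+ 2)] lies
    in J. *)
Lemma nc_center_ge : (\dim {:A} < \dim Z + \dim (J ^+ 2))%N.
Proof.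
have: (<[1]> + perp (J ^+ 2) <= Z)%VS by rewrite subv_add -memvE memv1Z soc2_center.
move/dimvS; rewrite dim_addline; last first.
  by apply: contra J1 => /(subvP nc_soc2_J).
have := dim_perp (J ^+ 2); dim_lia.
Qed.

Lemma nc_dim_J2 : (\dim (J ^+ 2) + 3 <= \dim {:A})%N.
Proof.
rewrite dim_J; have [//|le_d] := leqP (\dim (J ^+ 2) + 2) (\dim J).
  by rewrite !addnS.
by case: ncA; apply: J_gen1_comm; move: le_d; rewrite addn2 ltnS.
Qed.

Lemma nc_perpZ_soc :
  \dim (perp Z + perp J) = (\dim (perp Z)).+1 /\ (perp Z + perp J <= J ^+ 2)%VS.
Proof.
rewrite dimv_disjoint_sum ?perpZ_cap_soc // dim_soc addn1; split=> //.
by rewrite subv_add perpZ_J2 soc_sub_Jpow // nc_J2.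
Qed.

(** The equality case of [nc_center_ge]: the direct sum of [perp Z] and the socle, always inside
    J^2, then has the dimension of J^2. *)
Lemma nc_J2_perpZ_soc : (\dim {:A} = \dim Z + \dim (J ^+ 2) - 1)%N ->
  (J ^+ 2 <= perp Z + perp J)%VS.
Proof.
move=> dZ; have [d_s s_J2] := nc_perpZ_soc.
rewrite -(geq_leqif (dimv_leqif_sup s_J2)) d_s; have := dim_perp Z; dim_lia.
Qed.

Lemma nc_J3_gen2 : (\dim {:A} <= \dim (J ^+ 2) + 3)%N ->
  (J ^+ 3)%VS != 0%VS /\ (\dim (J ^+ 3) + 2 <= \dim (J ^+ 2))%N.
Proof.
rewrite dim_J addn3 ltnS => le_d; have [x [y [Jx Jy sJ]]] := J_gen2 le_d; split.
  by apply/eqP => J30; apply: ncA; apply: comm_gen2_J3 Jx Jy sJ J30.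
rewrite leqNgt; apply/negP; rewrite addn2 ltnS => le_d3.
have [q _ sJ2] := addline_exists le_d3 (Jpow_sub (isT : 0 < 2 <= 3)%N).
by apply: ncA; apply: comm_gen2 Jx Jy sJ sJ2.
Qed.

(** If J^2 has codimension at least 4, [nc_center_ge] suffices. In codimension 3 there are two
    generators x, y, and dim Z = 4 would be the equality case, where x y - y x spans J^2 modulo J^3,
    contrary to [comm_gen2]. *)
Lemma nc_dim_center5 : (5 <= \dim Z)%N.
Proof.
have gZ := nc_center_ge; have gJ2 := nc_dim_J2.
have [le_d|] := leqP (\dim {:A}) (\dim (J ^+ 2) + 3); last by dim_lia.
rewrite leqNgt; apply/negP => lt_Z.
have [x [y [Jx Jy sJ]]]: exists x y,
    [/\ x \in J, y \in J & (J <= <[x]> + (<[y]> + J ^+ 2))%VS].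
  by apply: J_gen2; move: le_d; rewrite dim_J addn3.
have [nzJ3 _] := nc_J3_gen2 le_d.
apply: ncA; apply: (@comm_gen2 x y (x * y - y * x)) => //.
apply: subv_trans (nc_J2_perpZ_soc _) _; first by dim_lia.
rewrite subv_add perpZ_gen2 //.
by apply: subv_trans (addvSr _ _); apply: soc_sub_Jpow.
Qed.

Lemma nc_dim8 : (8 <= \dim {:A})%N.
Proof. have := nc_dim_center; have := nc_dim_center5; dim_lia. Qed.

Hypothesis dimA : \dim {:A} = 8%N.

Let dimZ : \dim Z = 5%N.
Proof. have := nc_dim_center; have := nc_dim_center5; dim_lia. Qed.

Let dim_perpZ : \dim (perp Z) = 3%N.
Proof. have := dim_perp Z; rewrite dimZ dimA; dim_lia. Qed.

Lemma nc_J3_soc n : (2 <= n)%N -> (1 < \dim (J ^+ n))%N -> (J ^+ n.+1)%VS != 0%VS.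
Proof.
move=> n2 d_n; apply/eqP => J0; have := dimvS (Jpow_soc J0); rewrite dim_soc.
by rewrite leqNgt d_n.
Qed.

(** Since dim Z = 5, this is the equality case of [nc_center_ge], so J^2 is the sum of [perp Z] and
    the socle. If dim J^3 = 3, [line_comm_J2] puts all commutators into J^3, so that J^2 = J^3. If
    dim J^3 = 2, [top_power_comm] makes J^2 orthogonal to itself, so that J^4 = 0. *)
Lemma nc8_gens3 : \dim (J ^+ 2) = 4%N ->
  \dim (J ^+ 3) = 1%N /\ (J ^+ 2 <= perp Z + J ^+ 3)%VS.
Proof.
move=> d2; have sJ2: (J ^+ 2 <= perp Z + perp J)%VS.
  by apply: nc_J2_perpZ_soc; rewrite dimA dimZ d2.
have nz3: (J ^+ 3)%VS != 0%VS by apply: nc_J3_soc; rewrite ?d2.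
have s_J3 := soc_sub_Jpow (isT : 0 < 3)%N nz3.
have sJ3: (J ^+ 2 <= perp Z + J ^+ 3)%VS by rewrite (subv_trans sJ2) ?addvS.
split=> //; have lt32: (\dim (J ^+ 3) < \dim (J ^+ 2))%N by apply: Jpow_dim nc_J2.
have d3_gt0: (0 < \dim (J ^+ 3))%N by rewrite lt0n dimv_eq0.
have [d3|[d3|//]]: (\dim (J ^+ 3) = 3 \/ \dim (J ^+ 3) = 2 \/ \dim (J ^+ 3) = 1)%N.
  by dim_lia.
- have cJ3 u v : u \in J -> v \in J -> u * v - v * u \in (J ^+ 3)%VS.
    move=> Ju Jv; apply/negPn/negP => J3c; case/eqP: nz3.
    apply: (line_comm_J2 Ju Jv).
    have Jc: u * v - v * u \in (J ^+ 2)%VS by apply: comm_J2.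
    have sJ32 := Jpow_sub (isT : 0 < 2 <= 3)%N.
    by rewrite {1}(addline_full Jc J3c sJ32) // d2 d3.
  case/eqP: nc_J2; apply: Jpow_stable.
  by apply: subv_trans sJ3 _; rewrite subv_add subvv andbT perpZ_sub //; apply: comm_J.
have nz4: (J ^+ 4)%VS != 0%VS by apply: nc_J3_soc; rewrite ?d3.
have d4: \dim (J ^+ 4) = 1%N.
  have: (\dim (J ^+ 4) < \dim (J ^+ 3))%N by apply: Jpow_dim nz3.
  have: (0 < \dim (J ^+ 4))%N.
    by rewrite lt0n dimv_eq0.
  dim_lia.
have sZ: (perp Z <= perp (J ^+ 2))%VS.
  apply: perpZ_sub; apply: comm_J => u v Ju Jv; apply/perpP => b Jb.
  exact: (@top_power_comm 1).
case/eqP: nz4; apply: (@Jpow_perp0 2 1); rewrite (subv_trans sJ2) // subv_add sZ.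
by rewrite sub_perp // -{2}[J]expv1 Jpow_sub.
Qed.

Lemma nc8_gens2 : \dim (J ^+ 2) = 5%N -> \dim (J ^+ 3) = 3%N /\ \dim (J ^+ 4) = 1%N.
Proof.
move=> d2; have [|nz3 le_d3] := nc_J3_gen2; first by rewrite dimA d2.
have [|x [y [Jx Jy sJ]]] := J_gen2.
  by have := dim_J; rewrite dimA d2; dim_lia.
(* Otherwise J^2, of dimension 5, would lie in its orthogonal, of dimension 3. *)
have nz4: (J ^+ 4)%VS != 0%VS.
  apply/eqP => J40; have := dimvS (@Jpow_sub_perp 2 2 J40).
  have := dim_perp (J ^+ 2); rewrite dimA d2; dim_lia.
have d4_gt0: (0 < \dim (J ^+ 4))%N by rewrite lt0n dimv_eq0.
have lt43: (\dim (J ^+ 4) < \dim (J ^+ 3))%N by apply: Jpow_dim nz3.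
have tcx: t ((x * y - y * x) * x) = 0.
  by rewrite mulrBl linearB /= -mulrA tC subrr.
have tcy: t ((x * y - y * x) * y) = 0.
  by rewrite mulrBl linearB /= -[y * x * y]mulrA [t (y * _)]tC subrr.
have [[d3 d4]|[[d3 d4]|//]]: (\dim (J ^+ 3) = 2 /\ \dim (J ^+ 4) = 1
    \/ \dim (J ^+ 3) = 3 /\ \dim (J ^+ 4) = 2
    \/ \dim (J ^+ 3) = 3 /\ \dim (J ^+ 4) = 1)%N by rewrite d2 in le_d3; dim_lia.
(* The commutator is orthogonal to x and y by cyclicity and to J^2 by [top_power_comm], hence to J;
   being also orthogonal to Z, it vanishes. *)
- have cJ2: x * y - y * x \in perp (J ^+ 2).
    by apply/perpP => b Jb; apply: (@top_power_comm 1).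
  have cJ: x * y - y * x \in perp J.
    apply/perpP => a /(J_span2 sJ)[k [l [r [Jr ->]]]].
    have cr0: t ((x * y - y * x) * r) = 0 by move/perpP: cJ2; apply.
    by rewrite !mulrDr !linearD -!scalerAr !linearZ /= tcx tcy cr0 !mulr0 !addr0.
  case: ncA; apply: (comm_gens sJ); apply/eqP; rewrite -subr_eq0 -memv0.
  by rewrite -perpZ_cap_soc memv_cap cJ comm_perp_center.
have nz5: (J ^+ 5)%VS != 0%VS by apply: nc_J3_soc; rewrite ?d4.
have d5: \dim (J ^+ 5) = 1%N.
  have: (\dim (J ^+ 5) < \dim (J ^+ 4))%N by apply: Jpow_dim nz4.
  rewrite d4.
  have: (0 < \dim (J ^+ 5))%N by rewrite lt0n dimv_eq0.
  dim_lia.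
have J60: (J ^+ 6)%VS = 0%VS by apply: Jpow_dim1; rewrite ?d5.
have swap u v b : u \in J -> v \in J -> b \in (J ^+ 3)%VS ->
    t (u * v * b) = t (v * u * b).
  move=> Ju Jv Jb; apply/eqP; rewrite -subr_eq0 -linearB -mulrBl.
  by rewrite (@top_power_comm 2).
(* With rotations, [swap] makes [t] symmetric on words of length five. *)
have cJ4 u b : u \in J -> b \in (J ^+ 2)%VS -> u * b - b * u \in (J ^+ 4)%VS.
  (* The intersection contains J^4 because J^6 = 0, and it is proper in J^3 because J^5 is nonzero;
     as dim J^3 = 3 and dim J^4 = 2, it is J^4. *)
  move=> Ju Jb; have J34: (J ^+ 3 :&: perp (J ^+ 2) <= J ^+ 4)%VS.
    have sJ4: (J ^+ 4 <= J ^+ 3 :&: perp (J ^+ 2))%VS.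
      by rewrite subv_cap Jpow_sub //= (@Jpow_sub_perp 4 2).
    have: (\dim (J ^+ 3 :&: perp (J ^+ 2)) < \dim (J ^+ 3))%N.
      rewrite (ltn_leqif (dimv_leqif_sup (capvSl _ _))) subv_cap subvv /=.
      by apply: contra nz5 => /(@Jpow_perp0 3 1)->.
    by rewrite d3 ltnS -(geq_leqif (dimv_leqif_sup sJ4)) d4.
  apply: (subvP J34); rewrite memv_cap; apply/andP; split.
    by apply: memvB; [apply: JpowS_mull | apply: JpowS_mulr].
  apply/perpP => b' Jb'; rewrite mulrBl linearB /=.
  have: t ((b' * u - u * b') * b) = 0.
    move: b Jb; rewrite expv2; apply: t_prod0 => p q Jp Jq.
    rewrite mulrBl linearB /=; apply/eqP; rewrite subr_eq0; apply/eqP.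
    transitivity (t (u * p * (q * b'))).
      by rewrite -[b' * u * _]mulrA [t (b' * _)]tC !mulrA.
    rewrite swap ?JpowS_mull //.
    transitivity (t (u * q * (b' * p))).
      by rewrite -[p * u * _]mulrA [t (p * _)]tC !mulrA.
    by rewrite swap ?JpowS_mulr // -[q * u * _]mulrA [t (q * _)]tC !mulrA.
  rewrite mulrBl linearB /= -[b' * u * b]mulrA [t (b' * _)]tC => <-.
  by rewrite -[b * u * b']mulrA [t (b * _)]tC.
have s_J4 := soc_sub_Jpow (isT : 0 < 4)%N nz4.
have [d_s _] := nc_perpZ_soc.
(* The left side has dimension 4, the right side at most 3. *)
have: (perp Z + perp J <= <[x * y - y * x]> + J ^+ 4)%VS.
  rewrite subv_add (perpZ_sub (comm_gen2_mod Jx Jy sJ cJ4)) /=.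
  by apply: subv_trans (addvSr _ _).
move/dimvS; rewrite d_s dim_perpZ; have := dim_addline_le (x * y - y * x) (J ^+ 4)%VS.
rewrite d4; dim_lia.
Qed.

End Noncommutative.

(** * Dimension 8 with two generators: making their squares fall into J^3 *)

Section EightDimTwoGenerators.

Hypothesis ncA : ~ commutative_alg.
Hypothesis dimA : \dim {:A} = 8%N.
Hypothesis dimJ2 : \dim (J ^+ 2) = 5%N.
Hypothesis dimJ3 : \dim (J ^+ 3) = 3%N.
Hypothesis dimJ4 : \dim (J ^+ 4) = 1%N.

Definition gens x y :=
  [/\ x \in J, y \in J & (J <= <[x]> + (<[y]> + J ^+ 2))%VS].

Lemma gensC x y : gens x y -> gens y x.
Proof. by case=> Jx Jy sJ; split=> //; rewrite addvA [(<[y]> + _)%VS]addvC -addvA. Qed.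

Lemma gens_addr x y k : gens x y -> gens x (y + k *: x).
Proof.
case=> Jx Jy sJ; split=> //; first by rewrite memvD ?memvZ.
rewrite (subv_trans sJ) // !subv_add; apply/and3P; split; first exact: addvSl.
  apply/memv_addline; exists (- k).
  by rewrite scaleNr opprK (subvP (addvSl _ _)) ?memv_line.
exact: subv_trans (addvSr _ _) (addvSr _ _).
Qed.

Lemma t_J2 x y p : gens x y ->
    (forall b, b \in (J ^+ 3)%VS -> t (p * b) = 0) ->
    t (p * (x * x)) = 0 -> t (p * (x * y)) = 0 ->
    t (p * (y * x)) = 0 -> t (p * (y * y)) = 0 ->
  forall b, b \in (J ^+ 2)%VS -> t (p * b) = 0.
Proof.
case=> Jx Jy sJ p0 pxx pxy pyx pyy b; rewrite expv2; apply: t_prod0 => u v Ju Jv.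
have [k1 [l1 [r1 [Jr1 def_u]]]] := J_span2 sJ Ju.
have [k2 [l2 [r2 [Jr2 def_v]]]] := J_span2 sJ Jv.
have ->: u * v = (k1 * k2) *: (x * x) + (k1 * l2) *: (x * y)
    + (l1 * k2) *: (y * x) + (l1 * l2) *: (y * y)
    + ((k1 *: x + l1 *: y) * r2 + r1 * v) by rewrite def_u def_v; alg_expand.
rewrite !mulrDr !linearD /= -!scalerAr !linearZ /= pxx pxy pyx pyy !mulr0 !add0r.
rewrite (p0 (_ * r2)) ?(p0 (r1 * v)) ?addr0 //; first exact: JpowS_mulr.
by apply: JpowS_mull; rewrite ?memvD ?memvZ.
Qed.

Let J50 : (J ^+ 5)%VS = 0%VS. Proof. by apply: Jpow_dim1; rewrite ?dimJ4. Qed.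

Let t_J5 b : b \in (J ^+ 5)%VS -> t b = 0.
Proof. by rewrite J50 memv0 => /eqP->; rewrite linear0. Qed.

Let J2J3 b b' : b \in (J ^+ 2)%VS -> b' \in (J ^+ 3)%VS -> t (b * b') = 0.
Proof. by move=> Jb Jb'; apply: t_J5; apply: (Jpow_mul (m := 2) (n := 3)). Qed.

Let soc_J4 : (J ^+ 4)%VS = perp J. Proof. exact: Jpow_soc_eq. Qed.

Let dim_perpZ_soc : \dim (perp Z + perp J) = 4%N.
Proof.
have [-> _] := nc_perpZ_soc ncA; have := dim_perp Z.
have := nc_dim_center ncA; have := nc_dim_center5 ncA; rewrite dimA; dim_lia.
Qed.

Lemma comm_notin_J3 x y : gens x y -> x * y - y * x \notin (J ^+ 3)%VS.
Proof.
case=> Jx Jy sJ; apply/negP => J3c.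
have: (perp Z + perp J <= J ^+ 3)%VS.
  rewrite subv_add; apply/andP; split; last by rewrite -soc_J4 Jpow_sub.
  rewrite (subv_trans (perpZ_gen2 Jx Jy sJ)) // subv_add subvv andbT.
  by rewrite -memvE.
by move/dimvS; rewrite dim_perpZ_soc dimJ3.
Qed.

Lemma t_comm_sqr x y : t ((x * y - y * x) * (x * x)) = 0.
Proof.
by rewrite mulrBl linearB /= -[x * y * _]mulrA [t (x * _)]tC !mulrA subrr.
Qed.

Lemma t_comm_sym x y : t ((x * y - y * x) * (x * y + y * x)) = 0.
Proof.
rewrite mulrBl linearB /= !mulrDr !linearD /= [t (y * x * (x * y))]tC.
have ->: t (y * x * (y * x)) = t (x * y * (x * y)).
  by rewrite -[y * x * _]mulrA [t (y * _)]tC !mulrA.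
by rewrite [X in _ - X]addrC subrr.
Qed.

(** Otherwise x x, c = x y - y x and J^3 span J^2. Commutators of J with c lie in the socle J^4, so
    all commutators are spanned by c and y (x x) - (x x) y modulo J^4. This leaves dimension at most
    3 for [perp Z] + socle, which has dimension 4. *)
Lemma sqr_in_comm x y : gens x y -> x * y - y * x \in perp (J ^+ 2) ->
  x * x \in (<[x * y - y * x]> + J ^+ 3)%VS.
Proof.
move=> gxy cJ2; have [Jx Jy sJ] := gxy; set c := x * y - y * x in cJ2 *.
apply/negPn/negP => J3xx; have J3c: c \notin (J ^+ 3)%VS := comm_notin_J3 gxy.
have [Jc Jxx]: c \in (J ^+ 2)%VS /\ x * x \in (J ^+ 2)%VS.
  by split; [apply: comm_J2 | apply: Jpow2_mul].
have defJ2: (J ^+ 2)%VS = (<[x * x]> + (<[c]> + J ^+ 3))%VS.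
  apply: addline_full => //.
    by rewrite subv_add -memvE Jc Jpow_sub.
  by rewrite dim_addline // dimJ2 dimJ3.
have uc u : u \in J -> u * c - c * u \in (J ^+ 4)%VS.
  move=> Ju; rewrite soc_J4; apply/perpP => v Jv; have /perpP c0 := cJ2.
  rewrite mulrBl linearB /= -!mulrA [t (u * _)]tC -mulrA.
  by rewrite !c0 ?subrr // Jpow2_mul.
have cW u b : u \in J -> b \in (J ^+ 2)%VS ->
    u * b - b * u \in (<[y * (x * x) - x * x * y]> + J ^+ 4)%VS.
  move=> Ju; rewrite {1}defJ2 => /memv_addline[k /memv_addline[l Jr]].
  have [k' [l' [s [Js def_u]]]] := J_span2 sJ Ju.
  set r := _ - _ - _ in Jr; apply/memv_addline; exists (k * l').
  have Ecomm: u * (x * x) - x * x * u =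
      l' *: (y * (x * x) - x * x * y) + (s * (x * x) - x * x * s).
    by rewrite def_u; alg_expand.
  have ->: b = r + l *: c + k *: (x * x) by rewrite /r !subrK.
  have ->: u * (r + l *: c + k *: (x * x)) - (r + l *: c + k *: (x * x)) * u =
      (u * r - r * u) + l *: (u * c - c * u) + k *: (u * (x * x) - x * x * u).
    by move: (c) (r) (x * x) => ? ? ?; alg_expand.
  have subK (a1 q1 s1 : A) : a1 + (q1 + s1) - q1 = a1 + s1.
    by rewrite addrA addrAC addrK.
  rewrite {}Ecomm [k *: (_ + _)]scalerDr [k *: (_ *: _)]scalerA subK.
  apply: memvD; first apply: memvD.
  - by apply: memvB; [apply: JpowS_mull | apply: JpowS_mulr].
  - by apply: memvZ; apply: uc.
  by apply: memvZ; apply: memvB; apply: (Jpow_mul (m := 2) (n := 2)).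
have: (perp Z + perp J <= <[c]> + (<[y * (x * x) - x * x * y]> + J ^+ 4))%VS.
  rewrite subv_add (perpZ_sub (comm_gen2_mod Jx Jy sJ cW)) -soc_J4 /=.
  exact: subv_trans (addvSr _ _) (addvSr _ _).
move/dimvS; rewrite dim_perpZ_soc leqNgt => /negP; case.
rewrite ltnS (leq_trans (dim_addline_le _ _)) // ltnS.
by rewrite (leq_trans (dim_addline_le _ _)) // dimJ4.
Qed.

(** If it were, x x and y y would be orthogonal to J^2 by [sqr_in_comm], and x y and y x would pair
    equally with J^2. Then every product of two words of length 2 can be turned into one containing
    a square, so J^2 is orthogonal to itself and J^4 = 0. *)
Lemma comm_notin_soc2 x y : gens x y -> x * y - y * x \notin perp (J ^+ 2).
Proof.
move=> gxy; apply/negP => cJ2; have [Jx Jy sJ] := gxy.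
have cN: y * x - x * y \in perp (J ^+ 2) by rewrite -opprB memvN.
have c0 b : b \in (J ^+ 2)%VS -> t ((x * y - y * x) * b) = 0 by move/perpP: cJ2; apply.
have sqr0 u c b : c \in perp (J ^+ 2) -> u * u \in (<[c]> + J ^+ 3)%VS ->
    b \in (J ^+ 2)%VS -> t (u * u * b) = 0.
  move=> /perpP c0' /memv_addline[k Juu] Jb.
  have := J2J3 Jb Juu; rewrite tC mulrBl linearB /= -scalerAl linearZ /= c0' //.
  by rewrite mulr0 subr0.
have xx0 b := @sqr0 x _ b cJ2 (sqr_in_comm gxy cJ2).
have yy0 b := @sqr0 y _ b cN (sqr_in_comm (gensC gxy) cN).
have J2xx := Jpow2_mul Jx Jx; have J2yy := Jpow2_mul Jy Jy.
have J2xy := Jpow2_mul Jx Jy; have J2yx := Jpow2_mul Jy Jx.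
have xyE b : b \in (J ^+ 2)%VS -> t (x * y * b) = t (y * x * b).
  by move=> /c0; rewrite mulrBl linearB /= => /eqP; rewrite subr_eq0 => /eqP.
have yxxy: t (y * x * (x * y)) = 0.
  by rewrite -[y * x * _]mulrA tC -!mulrA mulrA xx0.
have xyyx: t (x * y * (y * x)) = 0.
  by rewrite -[x * y * _]mulrA tC -!mulrA mulrA yy0.
have yx0 b : b \in (J ^+ 2)%VS -> t (y * x * b) = 0.
  apply: (t_J2 gxy) => [b'|||| ]; first exact: J2J3.
  - by rewrite tC xx0.
  - by [].
  - by rewrite -xyE.
  - by rewrite tC yy0.
have: (J ^+ 2 <= perp (J ^+ 2))%VS.
  apply/subvP => b Jb; apply/perpP => b' Jb'; rewrite tC.
  move: b Jb; apply: (t_J2 gxy) => [b|||| ]; first exact: J2J3.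
  - by rewrite tC xx0.
  - by rewrite tC xyE // yx0.
  - by rewrite tC yx0.
  - by rewrite tC yy0.
by move/(@Jpow_perp0 2 1) => J40; have := dimJ4; rewrite J40 dimv0.
Qed.

(* [c = [x, y]] is orthogonal to all squares; hence modulo [J^3] the squares of
   elements of [J] lie on a line, and squaring is a quadratic form on [J/J^2]. *)
Lemma sqr_line x y : gens x y -> exists n,
  [/\ forall u, u \in J -> exists k, u * u - k *: n \in (J ^+ 3)%VS
    & exists k, x * y + y * x - k *: n \in (J ^+ 3)%VS].
Proof.
move=> gxy; have [Jx Jy sJ] := gxy; set c := x * y - y * x.
have Jc: c \in (J ^+ 2)%VS by apply: comm_J2.
pose P := (J ^+ 2 :&: perp <[c]>)%VS.
have PE b : b \in (J ^+ 2)%VS -> t (c * b) = 0 -> b \in P.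
  move=> Jb cb; rewrite memv_cap Jb; apply/perpP => _ /vlineP[k ->].
  by rewrite -scalerAr linearZ /= tC cb mulr0.
have ltP: (\dim P < \dim (J ^+ 2))%N.
  rewrite (ltn_leqif (dimv_leqif_sup (capvSl _ _))) subv_cap subvv /=.
  apply: contra (comm_notin_soc2 gxy) => /subvP sJP; apply/perpP => b /sJP/perpP.
  by rewrite tC; apply; apply: memv_line.
have sJ3: (J ^+ 3 <= P)%VS.
  apply/subvP => b Jb; apply: PE; last exact: J2J3.
  exact: Jpow_mem Jb _.
have [|n _ sP] := addline_exists _ sJ3; first by rewrite dimJ3 -ltnS -dimJ2.
have txy: t (c * (x * y + y * x)) = 0 := t_comm_sym x y.
exists n; split=> [u Ju|]; last first.
  by apply/memv_addline/(subvP sP)/PE; rewrite ?memvD ?Jpow2_mul.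
apply/memv_addline/(subvP sP)/PE; first exact: Jpow2_mul.
have [k [l [r [Jr def_u]]]] := J_span2 sJ Ju.
have ->: u * u = (k * k) *: (x * x) + (k * l) *: (x * y + y * x) + (l * l) *: (y * y)
    + ((k *: x + l *: y) * r + r * u) by rewrite def_u; alg_expand.
have tyy: t (c * (y * y)) = 0.
  have := t_comm_sqr y x; rewrite -[y * x - x * y]opprB -/c mulNr linearN.
  by move/eqP; rewrite oppr_eq0 => /eqP.
rewrite !mulrDr -!scalerAr !linearD !linearZ /= t_comm_sqr txy tyy !mulr0 !add0r.
rewrite (J2J3 Jc (b' := _ * r)) ?(J2J3 Jc (b' := r * u)) ?addr0 //.
  exact: JpowS_mulr.
by apply: JpowS_mull; rewrite ?memvD ?memvZ.
Qed.

(** A zero of the quadratic form of [sqr_line] yields a generator x with square in J^3. If the polar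
    value b at (x, y) is nonzero, shifting y along x kills its square as well; if b = 0, then x y -
    y x would be orthogonal to J^2, against [comm_notin_soc2]. *)
Lemma sqr_zero_gens :
    (forall b c : F, exists k, k * k + b * k + c = 0) ->
  exists x y, [/\ gens x y, x * x \in (J ^+ 3)%VS, y * y \in (J ^+ 3)%VS
    & x * y - y * x \notin (J ^+ 3)%VS].
Proof.
move=> quadF.
have [x [y [gxy Jxx]]]: exists x y, gens x y /\ x * x \in (J ^+ 3)%VS.
  have [|x [y gxy]] := J_gen2; first by have := dim_J; rewrite dimA dimJ2; dim_lia.
  have {}gxy: gens x y by [].
  have [Jx Jy _] := gxy; have [n [sq [b Jb]]] := sqr_line gxy.
  have [a Ja] := sq x Jx; have [d Jd] := sq y Jy.
  have [a0|nza] := eqVneq a 0.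
    by exists x, y; split=> //; rewrite a0 scale0r subr0 in Ja.
  (* Modulo J^3, the square of y + k x is (a k^2 + b k + d) n; division by a makes the equation
     monic. *)
  have [k root_k] := quadF (b / a) (d / a).
  exists (y + k *: x), x; split; first exact/gensC/gens_addr.
  have {}root_k: k * k * a + k * b + d = 0.
    apply: (mulIf (invr_neq0 nza)); rewrite mul0r -[RHS]root_k; by field.
  have ->: (y + k *: x) * (y + k *: x) = (y * y - d *: n)
      + k *: (x * y + y * x - b *: n) + (k * k) *: (x * x - a *: n)
      + (k * k * a + k * b + d) *: n by rewrite !scalerDl; alg_expand.
  by rewrite root_k scale0r addr0; memv_lin.
have [Jx Jy sJ] := gxy; have [n [sq [b Jb]]] := sqr_line gxy.
have [d Jd] := sq y Jy; have J50' := J2J3.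
have [b0|nzb] := eqVneq b 0; last first.
  exists x, (y + - (d / b) *: x); have g' := gens_addr (- (d / b)) gxy.
  split=> //; last exact: comm_notin_J3.
  have ->: (y + - (d / b) *: x) * (y + - (d / b) *: x) = (y * y - d *: n)
      - (d / b) *: (x * y + y * x - b *: n) + (d / b * (d / b)) *: (x * x)
      + (d - (d / b) * b) *: n by rewrite scalerBl; alg_expand.
  by rewrite divfK // subrr scale0r addr0; memv_lin.
case/negP: (comm_notin_soc2 gxy); rewrite b0 scale0r subr0 in Jb.
have [J2xx J2xy J2yx] := And3 (Jpow2_mul Jx Jx) (Jpow2_mul Jx Jy) (Jpow2_mul Jy Jx).
have yxxy: t (y * x * (x * y)) = 0.
  rewrite -[y * x * _]mulrA tC !mulrA -mulrA tC; apply: J2J3 => //.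
  exact: Jpow2_mul.
have xyxy: t (x * y * (x * y)) = 0.
  by have := J2J3 J2xy Jb; rewrite mulrDr linearD /= [t (_ * (y * x))]tC yxxy addr0.
have c0 b' : b' \in (J ^+ 2)%VS -> t ((x * y - y * x) * b') = 0.
  apply: (t_J2 gxy) => [b''|||| ].
  - exact: J2J3 (comm_J2 _ _).
  - exact: t_comm_sqr.
  - by rewrite mulrBl linearB /= xyxy yxxy subrr.
  - rewrite mulrBl linearB /= [t (x * y * _)]tC yxxy.
    by rewrite -[y * x * (y * x)]mulrA [t (y * _)]tC !mulrA -mulrA xyxy subrr.
  have := t_comm_sqr y x; rewrite -[y * x - x * y]opprB mulNr linearN => /eqP.
  by rewrite oppr_eq0 => /eqP.
exact/perpP.
Qed.

End EightDimTwoGenerators.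

End SymLocal.

(** * The quotient by the annihilator of a central element *)

(* For a central [z], the algebra [A / Ann(z)] is realized on the ideal [z A]
   through [a + Ann(z) |-> z a]; its unit is [z]. *)
Section Quotient.

Local Open Scope ring_scope.

Variables (F : fieldType) (A : falgType F) (z : A).

(** The proofs are phantom arguments, so that the structures attached to the type can recover them:
    centrality makes the product well defined, and z != 0 gives 1 != 0. *)
Definition quot (_ : z \in 'Z({:A})%VS) (_ : z != 0) : Type :=
  subvs_of (limg (amull z)).

Hypotheses (zZ : z \in 'Z({:A})%VS) (nz : z != 0).

HB.instance Definition _ := Vector.copy (quot zZ nz) (subvs_of (limg (amull z))).

Fact quot_subproof a : z * a \in limg (amull z).
Proof. by apply/memv_imgP; exists a; rewrite ?memvf ?lfunE. Qed.

Definition quot_proj (a : A) : quot zZ nz := Subvs (quot_subproof a).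

Definition quot_repr (u : quot zZ nz) : A := (amull z)^-1%VF (vsval u).

Lemma quot_reprK u : quot_proj (quot_repr u) = u.
Proof.
apply: val_inj => /=; have := limg_lfunVK (subvsP u); rewrite lfunE /=.
exact.
Qed.

Lemma quot_projP a b : quot_proj a = quot_proj b <-> z * (a - b) = 0.
Proof.
split=> [/(congr1 val)/= ab|/eqP]; first by rewrite mulrBr ab subrr.
by rewrite mulrBr subr_eq0 => /eqP ab; apply: val_inj.
Qed.

Definition quot_mul u v := quot_proj (quot_repr u * quot_repr v).

(** Independence of representatives: changing a factor by an element killed by z changes the product
    by an element killed by z, as z is central. The ring axioms are then inherited from A. *)
Lemma quot_projM a b : quot_proj (a * b) = quot_mul (quot_proj a) (quot_proj b).
Proof.
have /centerP zC := zZ.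
have /quot_projP Ea := quot_reprK (quot_proj a).
have /quot_projP Eb := quot_reprK (quot_proj b).
apply/esym/quot_projP; set a' := quot_repr _ in Ea *; set b' := quot_repr _ in Eb *.
have ->: a' * b' - a * b = (a' - a) * b' + a * (b' - b).
  by rewrite mulrBl mulrBr addrA subrK.
by rewrite mulrDr !mulrA Ea mul0r add0r zC -mulrA Eb mulr0.
Qed.

Lemma quot_proj_linear : linear quot_proj.
Proof.
by move=> k a b; apply: val_inj => /=; rewrite mulrDr -scalerAr.
Qed.

HB.instance Definition _ :=
  GRing.isLinear.Build F A (quot zZ nz) _ quot_proj quot_proj_linear.

Let projD a b : quot_proj (a + b) = quot_proj a + quot_proj b.
Proof. exact: linearD. Qed.

Fact quot_mulA : associative quot_mul.
Proof.
move=> u v w; rewrite -(quot_reprK u) -(quot_reprK v) -(quot_reprK w).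
by rewrite -!quot_projM mulrA.
Qed.

Fact quot_mul1 : left_id (quot_proj 1) quot_mul.
Proof. by move=> u; rewrite -(quot_reprK u) -quot_projM mul1r. Qed.

Fact quot_mulr1 : right_id (quot_proj 1) quot_mul.
Proof. by move=> u; rewrite -(quot_reprK u) -quot_projM mulr1. Qed.

Fact quot_mulDl : left_distributive quot_mul +%R.
Proof.
move=> u v w; rewrite -(quot_reprK u) -(quot_reprK v) -(quot_reprK w).
by rewrite -projD -!quot_projM mulrDl projD.
Qed.

Fact quot_mulDr : right_distributive quot_mul +%R.
Proof.
move=> u v w; rewrite -(quot_reprK u) -(quot_reprK v) -(quot_reprK w).
by rewrite -projD -!quot_projM mulrDr projD.
Qed.

Fact quot_1_neq0 : quot_proj 1 != 0.
Proof. by apply: contra nz => /eqP/(congr1 val)/=; rewrite mulr1 => ->. Qed.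

HB.instance Definition _ := GRing.Zmodule_isNzRing.Build (quot zZ nz)
  quot_mulA quot_mul1 quot_mulr1 quot_mulDl quot_mulDr quot_1_neq0.

Let projZ k a : quot_proj (k *: a) = k *: quot_proj a.
Proof. exact: linearZ. Qed.

Let mulE (u v : quot zZ nz) : u * v = quot_mul u v. Proof. by []. Qed.

Fact quot_scaleAl k (u v : quot zZ nz) : k *: (u * v) = (k *: u) * v.
Proof.
rewrite -(quot_reprK u) -(quot_reprK v) !mulE -!quot_projM -!projZ.
by rewrite -quot_projM scalerAl.
Qed.

HB.instance Definition _ :=
  GRing.Lmodule_isLalgebra.Build F (quot zZ nz) quot_scaleAl.

Fact quot_scaleAr k (u v : quot zZ nz) : k *: (u * v) = u * (k *: v).
Proof.
rewrite -(quot_reprK u) -(quot_reprK v) !mulE -!quot_projM -!projZ.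
by rewrite -quot_projM scalerAr.
Qed.

HB.instance Definition _ :=
  GRing.Lalgebra_isAlgebra.Build F (quot zZ nz) quot_scaleAr.

HB.instance Definition _ := Algebra_isFalgebra.Build F (quot zZ nz).

Fact quot_proj_monoid_morphism : monoid_morphism quot_proj.
Proof. by split=> // a b; rewrite quot_projM. Qed.

HB.instance Definition _ :=
  GRing.isMonoidMorphism.Build A (quot zZ nz) quot_proj quot_proj_monoid_morphism.

Definition quot_hom : 'AHom(A, quot zZ nz) := linfun_ahom quot_proj.

Lemma quot_homE a : quot_hom a = quot_proj a. Proof. exact: lfunE. Qed.

Lemma quot_hom_eq0 a : (quot_hom a == 0) = (z * a == 0).
Proof. by rewrite quot_homE -(inj_eq val_inj). Qed.

Lemma quot_hom_surj u : exists a, u = quot_hom a.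
Proof. by exists (quot_repr u); rewrite quot_homE quot_reprK. Qed.

Variable t : {scalar A}.

Definition quot_form (u : quot zZ nz) : F := t (vsval u).

Fact quot_form_linear : scalar quot_form.
Proof. by move=> k u v; rewrite /quot_form !linearP. Qed.

HB.instance Definition _ :=
  GRing.isLinear.Build F (quot zZ nz) F _ quot_form quot_form_linear.

Lemma quot_formE a : quot_form (quot_hom a) = t (z * a).
Proof. by rewrite quot_homE. Qed.

(** The form is nondegenerate because t (z a b) = 0 for all b forces z a = 0, which says that the
    class of a is zero. *)
Lemma quot_sym_local J : sym_local t J -> sym_local quot_form (quot_hom @: J)%VS.
Proof.
move=> AJ; have /centerP zC := zZ; split.
- move=> u v; have [a ->] := quot_hom_surj u; have [b ->] := quot_hom_surj v.
  rewrite -!rmorphM /= !quot_formE mulrA (tC AJ).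
  by rewrite [b * (_ * _)]mulrA -zC -mulrA.
- move=> u u0; have [a def_u] := quot_hom_surj u; rewrite {}def_u in u0 *.
  apply/eqP; rewrite quot_hom_eq0; apply/eqP/(t_nondeg AJ) => b.
  by have := u0 (quot_hom b); rewrite -rmorphM /= quot_formE mulrA.
- rewrite /ideal_of subvf /=; apply/andP; split; apply/prodvP => u v.
    move=> _ /memv_imgP[j Jj ->]; have [a ->] := quot_hom_surj u.
    by rewrite -rmorphM memv_img // (J_mull AJ).
  move=> /memv_imgP[j Jj ->] _; have [a ->] := quot_hom_surj v.
  by rewrite -rmorphM memv_img // (J_mulr AJ).
- rewrite -(aimg1 quot_hom) -limgD; case: AJ => _ _ _ -> _.
  apply/eqP; rewrite eqEsubv subvf; apply/subvP => u _.
  by have [a ->] := quot_hom_surj u; rewrite memv_img ?memvf.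
by case: AJ => _ _ _ _ [n Jn0]; exists n; rewrite -aimgX Jn0 limg0.
Qed.

Lemma limg_quot_hom : limg quot_hom = fullv.
Proof.
apply/eqP; rewrite eqEsubv subvf; apply/subvP => u _.
by have [a ->] := quot_hom_surj u; rewrite memv_img ?memvf.
Qed.

Lemma memv_quot_hom (U : {vspace A}) a :
  (quot_hom a \in quot_hom @: U)%VS = (a \in U + lker quot_hom)%VS.
Proof.
apply/idP/idP => [/memv_imgP[u Uu /eqP]|/memv_addP[u Uu [v kv ->]]].
  rewrite -subr_eq0 -linearB -memv_ker => kau.
  by rewrite -[a](subrK u) addrC memv_add.
by move: kv; rewrite memv_ker => /eqP kv; rewrite linearD /= kv addr0 memv_img.
Qed.

Lemma dim_quot_img (U : {vspace A}) :
  (\dim (quot_hom @: U) + \dim (lker quot_hom))%N = \dim (U + lker quot_hom).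
Proof.
have -> : (quot_hom @: U = quot_hom @: (U + lker quot_hom))%VS.
  by rewrite limgD; have /eqP -> : (quot_hom @: lker quot_hom == 0)%VS;
    rewrite ?addv0 // -lkerE.
rewrite -(limg_ker_dim quot_hom (U + lker quot_hom)) addnC.
by have /capv_idPr-> := addvSr U (lker quot_hom).
Qed.

End Quotient.

(** * Algebras of dimension sixteen *)

Section Sixteen.

Local Open Scope ring_scope.

Variables (F : fieldType) (A : falgType F) (t : {scalar A}) (J : {vspace A}).
Variable z : A.
Hypothesis AJ : sym_local t J.
Hypotheses (zZ : z \in 'Z({:A})%VS) (nz : z != 0) (Jz : z \in J).
Hypothesis z_soc : forall w, w \in 'Z({:A})%VS -> w \in J -> z * w = 0.
Hypothesis ncz : exists a b, z * (a * b - b * a) != 0.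
Hypothesis dimA_le : (\dim {:A} <= 16)%N.

Local Notation Z := 'Z({:A})%VS.
Local Notation C := (quot zZ nz).
Local Notation h := (quot_hom zZ nz).
Local Notation tz := (@quot_form F A z zZ nz t).
Local Notation JC := (h @: J)%VS.

Let CJ : sym_local tz JC := @quot_sym_local F A z zZ nz t J AJ.

Let zC a : z * a = a * z. Proof. exact: (centerP z zZ). Qed.

Lemma quot_nc : ~ commutative_alg C.
Proof.
move=> cC; have [a [b]] := ncz; rewrite -quot_hom_eq0 => /negP; apply.
by rewrite rmorphB !rmorphM /= cC subrr.
Qed.

Definition annz := lker h.

Lemma annzP a : (a \in annz) = (z * a == 0).
Proof. by rewrite memv_ker quot_hom_eq0. Qed.

Let zz : z * z = 0. Proof. exact: z_soc. Qed.

Let dims : [/\ \dim {:A} = 16, \dim annz = 8 & \dim {:C} = 8]%N.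
Proof.
have d1: (\dim {:C} + \dim annz)%N = \dim {:A}.
  by rewrite -(limg_quot_hom zZ nz) dim_quot_img -/annz sumfv.
have dC := nc_dim8 CJ quot_nc.
have d2: (\dim (limg (amull z)) + \dim (lker (amull z)))%N = \dim {:A}.
  by rewrite -(limg_ker_dim (amull z) fullv) capfv addnC.
have kE: lker (amull z) = annz.
  by apply/vspaceP => a; rewrite annzP memv_ker lfunE.
have: (\dim (limg (amull z)) <= \dim annz)%N.
  apply/dimvS/subvP => _ /memv_imgP[a _ ->].
  by rewrite lfunE annzP /= mulrA zz mul0r.
by move: d2; rewrite kE => d2 le_zA; move: dimA_le; split; dim_lia.
Qed.

Let dimA : \dim {:A} = 16%N. Proof. by case: dims. Qed.
Let dimI : \dim annz = 8%N. Proof. by case: dims. Qed.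
Let dimC : \dim {:C} = 8%N. Proof. by case: dims. Qed.

Lemma annz_mulz a : a \in annz -> exists b, a = z * b.
Proof.
have kE: lker (amull z) = annz.
  by apply/vspaceP => b; rewrite annzP memv_ker lfunE.
have d2: (\dim (limg (amull z)) + \dim (lker (amull z)))%N = \dim {:A}.
  by rewrite -(limg_ker_dim (amull z) fullv) capfv addnC.
have sI: (limg (amull z) <= annz)%VS.
  apply/subvP => _ /memv_imgP[b _ ->].
  by rewrite lfunE annzP /= mulrA zz mul0r.
have ->: annz = limg (amull z).
  apply/esym/eqP; rewrite eqEdim sI /=; move: d2; rewrite kE dimA dimI; dim_lia.
by case/memv_imgP => b _ ->; exists b; rewrite lfunE.
Qed.

Lemma mulz_annz a : z * a \in annz.
Proof. by rewrite annzP mulrA zz mul0r. Qed.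

Lemma annz_mull a b : b \in annz -> a * b \in annz.
Proof. by rewrite !annzP => /eqP zb; rewrite mulrA zC -mulrA zb mulr0. Qed.

Lemma annz_mulr a b : a \in annz -> a * b \in annz.
Proof. by rewrite !annzP mulrA => /eqP->; rewrite mul0r. Qed.

Lemma annz_mul0 a b : a \in annz -> b \in annz -> a * b = 0.
Proof.
rewrite annzP => /eqP za0 /annz_mulz[c ->].
by rewrite mulrA -zC za0 mul0r.
Qed.

(** Products inside [annz] = z A vanish since z z = 0, and [annz] has half the dimension of A. *)
Lemma annz_perp : perp t annz = annz.
Proof.
apply/esym/eqP; rewrite eqEdim; have := dim_perp AJ annz; rewrite dimA dimI => d.
apply/andP; split; last by dim_lia.
by apply/subvP => a Ia; apply/perpP => b Ib; rewrite annz_mul0 ?linear0.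
Qed.

Let ncA : ~ commutative_alg A.
Proof. by move=> cA; have [a [b]] := ncz; rewrite (cA a b) subrr mulr0 eqxx. Qed.

Lemma center_annz w : w \in Z -> w \in J -> w \in annz.
Proof. by move=> Zw Jw; rewrite annzP z_soc. Qed.

Lemma annz_J2 : (annz <= J ^+ 2)%VS.
Proof.
rewrite -annz_perp -[(J ^+ 2)%VS](perpK AJ) sub_perp //; apply/subvP => p Pp.
apply: center_annz; first exact: (subvP (soc2_center AJ)).
exact: (subvP (nc_soc2_J AJ ncA)).
Qed.

Lemma annz_J : (annz <= J)%VS.
Proof. by rewrite (subv_trans annz_J2) // -{2}[J]expv1 (Jpow_sub AJ). Qed.

Lemma annz_perpZ_soc : (annz <= perp t Z + perp t J)%VS.
Proof.
have sZJ: (Z :&: J <= annz)%VS by apply/subvP => w /memv_capP[]; apply: center_annz.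
have defZJ: (Z :&: J)%VS = perp t (perp t Z + perp t J) by rewrite perpD !(perpK AJ).
by have := sub_perp t sZJ; rewrite defZJ (perpK AJ) annz_perp.
Qed.

Lemma annz_decomp a : a \in annz -> exists k j, j \in J /\ a = k *: z + z * j.
Proof.
case/annz_mulz => b ->; have [k Jb] := J_decomp AJ b.
by exists k, (b - k%:A); split=> //; rewrite mulrBr -scalerAr mulr1 addrC subrK.
Qed.

(** A hyperplane of [annz], which is F z + z J by [annz_decomp]. *)
Definition zJ := (amull z @: J)%VS.

Lemma mem_zJ j : j \in J -> z * j \in zJ.
Proof. by move=> Jj; rewrite -[z * j]/((z \*o idfun) j) -lfunE memv_img. Qed.

Lemma dim_zJ : \dim zJ = 7%N.
Proof.
have := limg_ker_dim (amull z) J; rewrite -/zJ.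
have /capv_idPr->: (lker (amull z) <= J)%VS.
  by apply: subv_trans annz_J; apply/subvP => a; rewrite annzP memv_ker lfunE.
have kE: lker (amull z) = annz.
  by apply/vspaceP => b; rewrite annzP memv_ker lfunE.
have := dim_J AJ; rewrite kE dimA dimI; dim_lia.
Qed.

Lemma annz_mul_zJ a j : a \in annz -> j \in J -> a * j \in zJ /\ j * a \in zJ.
Proof.
case/annz_mulz => b -> Jj; split; first by rewrite -mulrA mem_zJ // (J_mull AJ).
by rewrite mulrA -zC -mulrA mem_zJ // (J_mulr AJ).
Qed.

Lemma JC_pow n : (JC ^+ n = h @: (J ^+ n))%VS.
Proof. by rewrite aimgX. Qed.

Lemma memJC n a : (h a \in JC ^+ n)%VS = (a \in J ^+ n + annz)%VS.
Proof. by rewrite JC_pow memv_quot_hom. Qed.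

Lemma dim_Jpow_annz n : \dim (J ^+ n + annz) = (\dim (JC ^+ n) + 8)%N.
Proof. by rewrite JC_pow -dimI dim_quot_img. Qed.

Lemma quot_perp (U : {vspace A}) a :
  (h a \in perp tz (h @: U))%VS = (z * a \in perp t U).
Proof.
apply/perpP/perpP => [a0 u Uu|a0 _ /memv_imgP[u Uu ->]].
  by rewrite -mulrA -(quot_formE zZ nz) rmorphM a0 // memv_img.
by rewrite -rmorphM /= quot_formE mulrA a0.
Qed.

(** The center of C has dimension 5, so [nc_center_ge] gives at least 4 and [nc_dim_J2] at most
    5. *)
Lemma dim_J2_cases :
  \dim (JC ^+ 2) = 5%N \/ \dim (JC ^+ 2) = 4%N.
Proof.
have := nc_center_ge CJ quot_nc; have := nc_dim_J2 CJ quot_nc.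
have := nc_dim_center CJ quot_nc; have := nc_dim_center5 CJ quot_nc.
rewrite dimC; dim_lia.
Qed.

Lemma dim_J2 : \dim (J ^+ 2) = (\dim (JC ^+ 2) + 8)%N.
Proof. by rewrite -dim_Jpow_annz; have /addv_idPl-> := annz_J2. Qed.

Let tzC a b : t (z * (a * b)) = t (z * (b * a)).
Proof. by rewrite mulrA (tC AJ) mulrA -zC -mulrA. Qed.

(** * Dimension sixteen: excluding three generators *)

Section ThreeGenerators.

Hypothesis dimJC2 : \dim (JC ^+ 2) = 4%N.

Let C_J3 : \dim (JC ^+ 3) = 1%N /\ (JC ^+ 2 <= perp tz 'Z({:C}) + JC ^+ 3)%VS.
Proof. exact: (nc8_gens3 CJ quot_nc dimC dimJC2). Qed.

Let JC3 : (JC ^+ 3)%VS = perp tz JC.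
Proof. by case: C_J3 => d3 _; apply: (Jpow_soc_eq CJ). Qed.

Let dimJ2 : \dim (J ^+ 2) = 12%N. Proof. by rewrite dim_J2 dimJC2. Qed.

Let dimJ : \dim J = 15%N. Proof. by have := dim_J AJ; rewrite dimA => -[]. Qed.

Let nzJ3 : (J ^+ 3)%VS != 0%VS.
Proof.
apply/eqP => J30; have [d3 _] := C_J3; have := dim_Jpow_annz 3.
by rewrite J30 add0v d3 dimI.
Qed.

Lemma three_J2_sub : (J ^+ 2 <= perp t Z + J ^+ 3)%VS.
Proof.
apply/subvP => a Ja; have [_ sJC2] := C_J3.
have sZ: (perp tz 'Z({:C}) <= h @: perp t Z)%VS.
  apply: (perpZ_sub CJ) => u v; have [b ->] := quot_hom_surj u.
  have [c ->] := quot_hom_surj v.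
  by rewrite -!rmorphM -rmorphB memv_img // (comm_perp_center AJ).
have: h a \in (h @: (perp t Z + J ^+ 3))%VS.
  rewrite limgD -JC_pow; apply: subvP (h a) _.
    exact: subv_trans sJC2 (addvS sZ (subvv _)).
  by rewrite JC_pow memv_img.
rewrite memv_quot_hom; apply/subvP; rewrite subv_add subvv /=.
rewrite (subv_trans annz_perpZ_soc) // addvS //.
exact: (soc_sub_Jpow AJ).
Qed.

Lemma three_gens : exists x y w,
  [/\ x \in J, y \in J, w \in J & (J <= <[x]> + (<[y]> + (<[w]> + J ^+ 2)))%VS].
Proof.
have sJ2: (J ^+ 2 <= J)%VS by rewrite -{2}[J]expv1 (Jpow_sub AJ).
have [w Jw J2w]: exists2 w, w \in J & w \notin (J ^+ 2)%VS.
  by apply: memv_dim_lt; rewrite dimJ dimJ2.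
have [y Jy J2y]: exists2 y, y \in J & y \notin (<[w]> + J ^+ 2)%VS.
  by apply: memv_dim_lt; rewrite dim_addline // dimJ dimJ2.
have [|| x Jx sJ] := @addline_exists _ _ (<[y]> + (<[w]> + J ^+ 2)) J.
- by rewrite !dim_addline // dimJ dimJ2.
- by rewrite !subv_add -!memvE Jy Jw.
by exists x, y, w.
Qed.

(** By [three_J2_sub], J^2 is spanned modulo J^3 by commutators, and three generators have only
    three of them; hence 12 - 3. *)
Lemma three_dimJ3 : (9 <= \dim (J ^+ 3))%N.
Proof.
have [x [y [w [Jx Jy Jw sJ]]]] := three_gens.
pose U := (<[x * y - y * x]> + (<[x * w - w * x]> + (<[y * w - w * y]> + J ^+ 3)))%VS.
have sJ3: (J ^+ 3 <= U)%VS.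
  by do 3![apply: subv_trans (addvSr _ _)].
have cU u v : u \in J -> v \in J -> u * v - v * u \in U.
  move=> Ju Jv; have J3U b : b \in (J ^+ 3)%VS -> b \in U by apply/subvP.
  have dec a : a \in J -> exists k l m, a - (k *: x + l *: y + m *: w) \in (J ^+ 2)%VS.
    move=> /(subvP sJ)/memv_addline[k /memv_addline[l /memv_addline[m Jr]]].
    by exists k, l, m; rewrite !opprD !addrA.
  have [k1 [l1 [m1 Jr1]]] := dec u Ju; have [k2 [l2 [m2 Jr2]]] := dec v Jv.
  pose u' := k1 *: x + l1 *: y + m1 *: w; pose v' := k2 *: x + l2 *: y + m2 *: w.
  pose r1 := u - u'; pose r2 := v - v'; rewrite -/u' -/r1 in Jr1; rewrite -/v' -/r2 in Jr2.
  have ->: u * v - v * u = (u' * v' - v' * u') + (u' * r2 - r2 * u') + (r1 * v - v * r1).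
    by rewrite /r1 /r2; move: (u') (v') => ? ?; alg_expand.
  have Ju': u' \in J by rewrite !memvD ?memvZ.
  have J3c b c : b \in J -> c \in (J ^+ 2)%VS -> b * c \in U /\ c * b \in U.
    by move=> Jb Jc; split; apply: J3U; [apply: JpowS_mull | apply: JpowS_mulr].
  have [U1 U2] := J3c _ _ Ju' Jr2; have [U3 U4] := J3c _ _ Jv Jr1.
  apply: memvD; last exact: memvB; apply: memvD; last exact: memvB.
  apply/memv_addline; exists (k1 * l2 - l1 * k2).
  apply/memv_addline; exists (k1 * m2 - m1 * k2).
  apply/memv_addline; exists (l1 * m2 - m1 * l2).
  suffices ->: u' * v' - v' * u' - (k1 * l2 - l1 * k2) *: (x * y - y * x) -
     (k1 * m2 - m1 * k2) *: (x * w - w * x) - (l1 * m2 - m1 * l2) *: (y * w - w * y) = 0.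
    exact: mem0v.
  by rewrite /u' /v'; alg_expand.
have: (J ^+ 2 <= U)%VS.
  rewrite (subv_trans three_J2_sub) // subv_add sJ3 andbT.
  by apply: (perpZ_sub AJ); apply: (comm_J AJ).
move/dimvS; rewrite dimJ2 => d12; have := leq_trans d12 (dim_addline_le _ _).
rewrite ltnS => d11; have := leq_trans d11 (dim_addline_le _ _).
by rewrite ltnS => d10; have := leq_trans d10 (dim_addline_le _ _).
Qed.

Lemma three_annz_J3 : (annz <= J ^+ 3)%VS /\ \dim (J ^+ 3) = 9%N.
Proof.
have [d3 _] := C_J3; have d9 := dim_Jpow_annz 3; rewrite d3 in d9.
have /eqP defJ3: (J ^+ 3 == J ^+ 3 + annz)%VS.
  by rewrite eqEdim addvSl d9 three_dimJ3.
by split; [rewrite defJ3 addvSr | rewrite defJ3 d9].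
Qed.

Let sIJ3 : (annz <= J ^+ 3)%VS. Proof. by case: three_annz_J3. Qed.
Let dimJ3 : \dim (J ^+ 3) = 9%N. Proof. by case: three_annz_J3. Qed.

Let J4_annz : (J ^+ 4 <= annz)%VS.
Proof.
have [d3 _] := C_J3; have JC4: (JC ^+ 4)%VS = 0%VS by apply: (Jpow_dim1 CJ); rewrite ?d3.
apply/subvP => a Ja; rewrite memv_ker; have: h a \in (JC ^+ 4)%VS.
  by rewrite JC_pow memv_img.
by rewrite JC4 memv0.
Qed.

Let tzJ4 a : a \in (J ^+ 4)%VS -> t (z * a) = 0.
Proof. by move=> /(subvP J4_annz); rewrite annzP => /eqP->; rewrite linear0. Qed.

Let perp_JC2 : perp tz (JC ^+ 2) = (JC ^+ 2)%VS.
Proof.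
have [d3 _] := C_J3; have JC4: (JC ^+ 4)%VS = 0%VS by apply: (Jpow_dim1 CJ); rewrite ?d3.
apply/esym/eqP; rewrite eqEdim (Jpow_sub_perp _ (m := 2) (n := 2) JC4) /=.
have := dim_perp CJ (JC ^+ 2)%VS; rewrite dimC dimJC2; dim_lia.
Qed.

(** A functional dual to x_j and vanishing on J^2 is represented by some p in [perp t (J ^+ 2)].
    Such a p is central and in J, hence p = z b_j; and b_j lies in J^2 because the square of the
    radical of C is its own orthogonal. *)
Lemma three_dual_bases : exists x b : 'I_3 -> A,
  [/\ forall i, x i \in J, forall i, b i \in (J ^+ 2)%VS,
      (J <= \sum_i <[x i]> + J ^+ 2)%VS,
      (J ^+ 2 <= \sum_i <[b i]> + J ^+ 3)%VS
    & forall i j, t (z * (x i * b j)) = (i == j)%:R].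
Proof.
have [x0 [x1 [x2 [Jx0 Jx1 Jx2 sJ0]]]] := three_gens.
pose x (i : 'I_3) := [:: x0; x1; x2]`_i.
have Jx i : x i \in J by rewrite /x; case: i => -[|[|[|]]].
have sJ: (J <= \sum_i <[x i]> + J ^+ 2)%VS.
  by rewrite !big_ord_recl big_ord0 addv0 -!addvA.
have xW j : x j \notin (\sum_(i | i != j) <[x i]> + J ^+ 2)%VS.
  apply/negP => Wx; have: (J <= \sum_(i | i != j) <[x i]> + J ^+ 2)%VS.
    rewrite (subv_trans sJ) // (bigD1 j) //= !subv_add -memvE Wx addvSr andbT /=.
    by rewrite addvSl.
  move/dimvS; rewrite dimJ leqNgt => /negP; case.
  rewrite ltnS (leq_trans (dimv_add_leqif _ _)) // dimJ2 -[14%N]/(2 + 12)%N leq_add2r.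
  rewrite (leq_trans (dimv_leq_sum _ _ _)) //.
  rewrite (@leq_trans (\sum_(i < 3 | i != j) 1)) //.
    by apply: leq_sum => i _; rewrite dim_vline; case: (x i != 0).
  by rewrite sum1_card -(leq_add2l 1) -{1}(card1 j) cardC card_ord.
have dual j : exists bj,
    [/\ bj \in (J ^+ 2)%VS & forall i, t (z * (x i * bj)) = (i == j)%:R].
  have [p Wp pj] := perp_separates AJ (xW j).
  move: (Wp); rewrite perpD => /memv_capP[Xp J2p].
  have /annz_mulz[bj def_p]: p \in annz.
    apply: center_annz; first exact: (subvP (soc2_center AJ)).
    exact: (subvP (nc_soc2_J AJ ncA)).
  have tp i : t (z * (x i * bj)) = t (p * x i) by rewrite tzC def_p mulrA.
  exists bj; split=> [|i].
    have: h bj \in perp tz (h @: (J ^+ 2)) by rewrite quot_perp -def_p.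
    rewrite -JC_pow perp_JC2 memJC; apply/subvP.
    by rewrite subv_add subvv annz_J2.
  rewrite tp; have [->//|ij] := eqVneq i j.
  move/perpP: Xp; apply; apply: (subvP (sumv_sup i ij (subvv _))).
  exact: memv_line.
have [b Hb] := fin_all_exists dual; exists x, b.
have xb i j : t (z * (x i * b j)) = (i == j)%:R by case: (Hb j).
have Jb i : b i \in (J ^+ 2)%VS by case: (Hb i).
split=> //; apply/subvP => a Ja.
pose a' := a - \sum_j t (z * (x j * a)) *: b j.
have Sb: \sum_j t (z * (x j * a)) *: b j \in (\sum_i <[b i]>)%VS.
  by apply: memv_sumr => j _; rewrite memvZ // memv_line.
rewrite -[a](subrK (\sum_j t (z * (x j * a)) *: b j)) addrC memv_add // -/a'.
(* Then the class of a' lies in the socle of C, which is the cube of its radical, so a' lies in J^3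
   + [annz] = J^3. *)
have: z * a' \in perp t J.
  apply/perpP => u /(subvP sJ)/memv_addP[v /memv_sumP[k Xk ->] [r Jr ->]].
  have Ja': a' \in (J ^+ 2)%VS.
    by rewrite memvB // memv_suml // => j _; rewrite memvZ.
  rewrite mulrDr linearD /= -[_ * r]mulrA (tzJ4 (Jpow_mul (m := 2) (n := 2) Ja' Jr)) addr0.
  rewrite mulr_sumr linear_sum big1 // => i _; have /vlineP[l ->] := Xk i isT.
  rewrite -scalerAr linearZ /= -mulrA tzC /a' mulrBr mulrBr linearB /=.
  rewrite mulr_sumr mulr_sumr linear_sum (bigD1 i) //= big1 => [|j ji].
    by rewrite -!scalerAr linearZ /= xb eqxx mulr1 addr0 subrr mulr0.
  by rewrite -!scalerAr linearZ /= xb eq_sym (negPf ji) mulr0.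
rewrite -quot_perp -JC3 memJC; apply/subvP.
by rewrite subv_add subvv.
Qed.

Let J3coef a g : a \in (J ^+ 3)%VS -> g \in (J ^+ 3)%VS -> t (z * g) = 1 ->
  a - t (z * a) *: g \in annz.
Proof.
move=> Ja Jg tg; have Ig: g \notin annz.
  apply: contraTN isT; rewrite annzP => /eqP zg; move/eqP: tg.
  by rewrite zg linear0 eq_sym oner_eq0.
have: a \in (<[g]> + annz)%VS by rewrite -(addline_full Jg Ig) // dimJ3 dimI.
case/memv_addline=> k Ik; suffices ->: t (z * a) = k by [].
have := Ik; rewrite annzP => /eqP/(congr1 t).
rewrite mulrBr -scalerAr linearB linearZ linear0 /= tg mulr1 => /eqP.
by rewrite subr_eq0 => /eqP.
Qed.

(** For a = k z + z j, pairing with g returns k, since z kills j * g in J^4. *)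
Let annz_zJ a g : a \in annz -> g \in (J ^+ 3)%VS -> t (z * g) = 1 ->
  t (a * g) = 0 -> a \in zJ.
Proof.
move=> /annz_decomp[k [j [Jj ->]]] Jg tg.
rewrite mulrDl -scalerAl linearD linearZ /= tg mulr1 -[z * j * g]mulrA.
by rewrite (tzJ4 (JpowS_mull Jj Jg)) addr0 => ->; rewrite scale0r add0r mem_zJ.
Qed.

Lemma three_false : False.
Proof.
have [x [b [Jx Jb sJ sJ2 xb]]] := three_dual_bases.
pose E i j := x i * b j.
have JE i j : E i j \in (J ^+ 3)%VS by rewrite JpowS_mull.
have tE i : t (z * E i i) = 1 by rewrite xb eqxx.
(* The third index k drives the argument: rotating x_i b_j x_k b_k gives (b_j x_k) (b_k x_i), a
   product of two elements of [annz], hence 0. *)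
have other (i j : 'I_3) : exists k, (k != i) && (k != j).
  by apply/existsP; move: i j; do 2![case=> -[|[|[|?]]] ?] => //;
    apply/existsP; (try by exists 0); (try by exists 1); exists 2%:R.
have bxI i k : i != k -> b i * x k \in annz.
  move=> ik; have := J3coef (JpowS_mulr (Jb i) (Jx k)) (JE i i) (tE i).
  by rewrite tzC xb eq_sym (negPf ik) scale0r subr0.
have tEE i k : i != k -> t (E i i * E k k) = 0.
  move=> ik; rewrite /E -mulrA (tC AJ).
  have ->: b i * (x k * b k) * x i = (b i * x k) * (b k * x i) by rewrite !mulrA.
  by rewrite annz_mul0 ?linear0 // bxI // eq_sym.
have DI i j : E i i - E j j \in annz.
  by have := J3coef (JE i i) (JE j j) (tE j); rewrite tE scale1r.
(* Against x_l, the element E i i may be replaced by E j j with j != l, and x_j (b_j x_l) lies in J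
   times [annz]. *)
have EJ i r : r \in J -> E i i * r \in zJ.
  move=> /(subvP sJ)/memv_addP[v /memv_sumP[k Xk ->] [{}r Jr ->]].
  rewrite mulrDr; apply: memvD; last first.
    have: E i i * r \in (J ^+ 4 * J)%VS.
      by rewrite -expvSr; apply: (Jpow_mul (m := 3) (n := 2)).
    apply/subvP/prodvP => u v' /(subvP J4_annz) Iu Jv.
    by case: (annz_mul_zJ Iu Jv).
  rewrite mulr_sumr memv_suml // => l _; have /vlineP[m ->] := Xk l isT.
  rewrite -scalerAr memvZ //; have [j /andP[_ jl]] := other i l.
  rewrite -[E i i](subrK (E j j)) mulrDl; apply: memvD.
    by case: (annz_mul_zJ (DI i j) (Jx l)).
  by rewrite -mulrA; case: (annz_mul_zJ (bxI j l jl) (Jx j)).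
have J4_zJ a r : a \in (J ^+ 3)%VS -> r \in J -> a * r \in zJ.
  move=> Ja Jr; rewrite -[a](subrK (t (z * a) *: E 0 0)) mulrDl -scalerAl.
  rewrite memvD ?memvZ ?EJ //.
  by case: (annz_mul_zJ (J3coef Ja (JE 0 0) (tE 0)) Jr).
have offdiag i j : i != j -> E i j \in zJ.
  move=> ij; have [k /andP[ki kj]] := other i j.
  have IE: E i j \in annz.
    have := J3coef (JE i j) (JE i i) (tE i).
    by rewrite xb (negPf ij) scale0r subr0.
  apply: (annz_zJ IE (JE k k) (tE k)); rewrite /E -mulrA (tC AJ).
  have ->: b j * (x k * b k) * x i = (b j * x k) * (b k * x i) by rewrite !mulrA.
  by rewrite annz_mul0 ?linear0 // bxI // eq_sym.
have tD i k : i != k ->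
    t (E 0 0 * E 0 0) + t ((E i i - E 0 0) * E 0 0) + t ((E k k - E 0 0) * E 0 0) = 0.
  move=> ik; rewrite -[RHS](tEE i k ik).
  have ->: E i i * E k k = E 0 0 * E 0 0 + (E i i - E 0 0) * E 0 0
      + E 0 0 * (E k k - E 0 0) + (E i i - E 0 0) * (E k k - E 0 0).
    by move: (E i i) (E k k) (E 0 0) => ? ? ?; alg_expand.
  rewrite (annz_mul0 (DI i 0) (DI k 0)) addr0 !linearD /=.
  by rewrite [t (E 0 0 * (E k k - E 0 0))](tC AJ).
(* Put T = t (E 0 0 * E 0 0) and c_i = t ((E i i - E 0 0) * E 0 0). The pairs (i, 0), (k, 0), (k, i)
   give T + c_i = T + c_k = T + c_k + c_i = 0, so c_i = 0 in every characteristic. *)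
have diag i : E i i - E 0 0 \in zJ.
  have [->|i0] := eqVneq i 0; first by rewrite subrr mem0v.
  apply: (annz_zJ (DI i 0) (JE 0 0) (tE 0)).
  have [k /andP[ki k0]] := other i 0.
  have e1 := tD i 0 i0; have e2 := tD k 0 k0; have e3 := tD k i ki.
  rewrite subrr mul0r linear0 addr0 in e1; rewrite subrr mul0r linear0 addr0 in e2.
  by have := e3; rewrite e2 add0r.
(* The contradiction: dimension 9 on the left, at most 8 on the right. *)
have: (J ^+ 3 <= <[E 0%R 0%R]> + zJ)%VS.
  have sJ4: {in (J ^+ 3)%VS & J, forall a r, a * r \in (<[E 0%R 0%R]> + zJ)%VS}.
    by move=> a r Ja Jr; apply: (subvP (addvSr _ _)); apply: J4_zJ.
  have sE i j : E i j \in (<[E 0%R 0%R]> + zJ)%VS.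
    have [->|ij] := eqVneq i j; last by apply: (subvP (addvSr _ _)); apply: offdiag.
    by apply/memv_addline; exists 1; rewrite scale1r diag.
  have J4_zJ' r a : a \in (J ^+ 3)%VS -> r \in J -> r * a \in (<[E 0%R 0%R]> + zJ)%VS.
    move=> Ja Jr; have: r * a \in (J ^+ 3 * J)%VS by rewrite -expvSr JpowS_mull.
    by apply/subvP/prodvP.
  rewrite expvSl; apply/prodvP => u c.
  move=> /(subvP sJ)/memv_addP[v /memv_sumP[k Xk ->] [r Jr ->]] Jc.
  rewrite mulrDl memvD //; last first.
    have: r * c \in (J ^+ 3 * J)%VS.
      by rewrite -expvSr; apply: (Jpow_mul (m := 2) (n := 2)).
    by apply/subvP/prodvP.
  rewrite mulr_suml memv_suml // => i _; have /vlineP[m ->] := Xk i isT.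
  rewrite -scalerAl memvZ //.
  have /memv_addP[w /memv_sumP[l Bl ->] [s Js ->]] := subvP sJ2 c Jc.
  rewrite mulrDr; apply: memvD; last exact: J4_zJ'.
  rewrite mulr_sumr memv_suml // => j _.
  by have /vlineP[m' ->] := Bl j isT; rewrite -scalerAr memvZ //; apply: sE.
move/dimvS; rewrite dimJ3 => d9; have := leq_trans d9 (dim_addline_le _ _).
by rewrite dim_zJ.
Qed.

End ThreeGenerators.

(** * Dimension sixteen: excluding two generators *)

Section TwoGenerators.

Hypothesis dimJC2 : \dim (JC ^+ 2) = 5%N.
Hypothesis quadF : forall b c : F, exists k, k * k + b * k + c = 0.

Let C_J34 : \dim (JC ^+ 3) = 3%N /\ \dim (JC ^+ 4) = 1%N.
Proof. exact: (nc8_gens2 CJ quot_nc dimC dimJC2). Qed.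

Let dimJ2 : \dim (J ^+ 2) = 13%N. Proof. by rewrite dim_J2 dimJC2. Qed.

Let dimJ : \dim J = 15%N. Proof. by have := dim_J AJ; rewrite dimA => -[]. Qed.

Let dimJ3I : \dim (J ^+ 3 + annz) = 11%N.
Proof. by rewrite dim_Jpow_annz; case: C_J34 => ->. Qed.

Let dimJ4I : \dim (J ^+ 4 + annz) = 9%N.
Proof. by rewrite dim_Jpow_annz; case: C_J34 => _ ->. Qed.

Let J5_annz : (J ^+ 5 <= annz)%VS.
Proof.
have [_ d4] := C_J34; have JC5: (JC ^+ 5)%VS = 0%VS by apply: (Jpow_dim1 CJ); rewrite ?d4.
apply/subvP => a Ja; rewrite memv_ker; have: h a \in (JC ^+ 5)%VS.
  by rewrite JC_pow memv_img.
by rewrite JC5 memv0.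
Qed.

Lemma two_lift_gens : exists x y,
  [/\ gens J x y, x * x \in (J ^+ 3 + annz)%VS, y * y \in (J ^+ 3 + annz)%VS
    & x * y - y * x \notin (J ^+ 3 + annz)%VS].
Proof.
have [d3 d4] := C_J34.
have [u [v [[Ju Jv sJ] uu vv c]]] := sqr_zero_gens CJ quot_nc dimC dimJC2 d3 d4 quadF.
have /memv_imgP[x Jx def_u] := Ju; have /memv_imgP[y Jy def_v] := Jv.
rewrite {}def_u {}def_v in sJ uu vv c; exists x, y; split.
- split=> //; apply/subvP => j Jj.
  have: h j \in (h @: (<[x]> + (<[y]> + J ^+ 2)))%VS.
    by rewrite !limgD !limg_line -JC_pow (subvP sJ) // memv_img.
  rewrite memv_quot_hom; apply/subvP; rewrite subv_add subvv /=.
  by rewrite (subv_trans annz_J2) // (subv_trans (addvSr <[y]> _)) ?addvSr.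
- by rewrite -memJC rmorphM.
- by rewrite -memJC rmorphM.
by rewrite -memJC rmorphB !rmorphM.
Qed.

(** [annz_perpZ_soc] puts [annz] into the span of x y - y x and J^3; a nonzero coefficient would put
    x y - y x into J^3 + [annz]. *)
Lemma two_annz_J3 : (annz <= J ^+ 3)%VS.
Proof.
have [x [y [[Jx Jy sJ] _ _ nc]]] := two_lift_gens.
have nzJ3: (J ^+ 3)%VS != 0%VS.
  by apply/eqP => J30; have := dimJ3I; rewrite J30 add0v dimI.
have sz: (annz <= <[x * y - y * x]> + J ^+ 3)%VS.
  rewrite (subv_trans annz_perpZ_soc) // subv_add (perpZ_gen2 AJ Jx Jy sJ) /=.
  by apply: subv_trans (addvSr _ _); apply: (soc_sub_Jpow AJ).
apply/subvP => a Ia; have /memv_addline[k Jk] := subvP sz a Ia.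
have [k0|nk] := eqVneq k 0; first by rewrite k0 scale0r subr0 in Jk.
case/negP: nc; rewrite -[x * y - y * x](scalerK nk) memvZ //.
by rewrite -[k *: _](subKr a) addrC memv_add ?memvN.
Qed.

Definition sqgens x y :=
  [/\ gens J x y, x * x \in (J ^+ 3)%VS, y * y \in (J ^+ 3)%VS
    & x * y - y * x \notin (J ^+ 3)%VS].

Let defJ3 : (J ^+ 3 + annz)%VS = (J ^+ 3)%VS.
Proof. exact/addv_idPl/two_annz_J3. Qed.

Let dimJ3 : \dim (J ^+ 3) = 11%N. Proof. by rewrite -defJ3. Qed.

Lemma two_sqgens : exists x y, sqgens x y.
Proof.
have [x [y [gxy xx yy c]]] := two_lift_gens.
by rewrite !defJ3 in xx yy c; exists x, y.
Qed.

Lemma sqgensC x y : sqgens x y -> sqgens y x.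
Proof.
case=> /gensC gyx xx yy c; split=> //.
by rewrite -opprB memvN.
Qed.

Lemma gens_notin_J2 x y : gens J x y -> x \notin (J ^+ 2)%VS.
Proof.
case=> Jx Jy sJ; apply/negP => J2x.
have: (J <= <[y]> + J ^+ 2)%VS.
  by rewrite (subv_trans sJ) // subv_add subvv andbT -memvE (subvP (addvSr _ _)).
move/dimvS; rewrite dimJ => d15; have := leq_trans d15 (dim_addline_le _ _).
by rewrite dimJ2.
Qed.

Lemma two_J2_span x y : sqgens x y -> (J ^+ 2 <= <[x * y]> + (<[y * x]> + J ^+ 3))%VS.
Proof.
case=> [[Jx Jy sJ] xx yy _]; rewrite expv2; apply/prodvP => u v Ju Jv.
have [k1 [l1 [r1 [Jr1 def_u]]]] := J_span2 sJ Ju.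
have [k2 [l2 [r2 [Jr2 def_v]]]] := J_span2 sJ Jv.
apply/memv_addline; exists (k1 * l2); apply/memv_addline; exists (l1 * k2).
have ->: u * v - (k1 * l2) *: (x * y) - (l1 * k2) *: (y * x) =
   (k1 * k2) *: (x * x) + (l1 * l2) *: (y * y) + ((k1 *: x + l1 *: y) * r2 + r1 * v).
  by rewrite def_u def_v; alg_expand.
apply: memvD; first by memv_lin.
by apply: memvD; [apply: JpowS_mull; memv_lin | apply: JpowS_mulr].
Qed.

(** The step from alternating words of length n to length n + 1: p starts with x and q with y, so x
    p and y q contain a square and drop to J^(n+2). *)
Lemma two_Jpow_span x y n p q : sqgens x y -> (2 <= n)%N ->
    p \in (J ^+ n)%VS -> q \in (J ^+ n)%VS ->
    x * p \in (J ^+ n.+2)%VS -> y * q \in (J ^+ n.+2)%VS ->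
    (J ^+ n <= <[p]> + (<[q]> + J ^+ n.+1))%VS ->
  (J ^+ n.+1 <= <[x * q]> + (<[y * p]> + J ^+ n.+2))%VS.
Proof.
case=> [[Jx Jy sJ] _ _ _] n2 Jp Jq xp yq sJn; rewrite expvSl; apply/prodvP => u b Ju Jb.
have [k1 [l1 [r1 [Jr1 def_u]]]] := J_span2 sJ Ju.
have /memv_addline[k2 /memv_addline[l2 Jr2]] := subvP sJn b Jb.
set r2 := b - k2 *: p - l2 *: q in Jr2.
apply/memv_addline; exists (k1 * l2); apply/memv_addline; exists (l1 * k2).
have def_b: b = k2 *: p + l2 *: q + r2 by rewrite addrC /r2 addrA addrAC !subrK.
have ->: u * b - (k1 * l2) *: (x * q) - (l1 * k2) *: (y * p) =
   (k1 * k2) *: (x * p) + (l1 * l2) *: (y * q) + ((k1 *: x + l1 *: y) * r2 + r1 * b).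
  by rewrite {}def_u {1 2}def_b; move: (r2) => ?; alg_expand.
apply: memvD; first by memv_lin.
apply: memvD; first by apply: JpowS_mull; memv_lin.
exact: (Jpow_mul (m := 2) (n := n)).
Qed.

Lemma two_J3_span x y : sqgens x y ->
  (J ^+ 3 <= <[x * (y * x)]> + (<[y * (x * y)]> + J ^+ 4))%VS.
Proof.
move=> gxy; have [[Jx Jy _] xx yy _] := gxy.
apply: (two_Jpow_span gxy) => //; rewrite ?Jpow2_mul //.
- by rewrite mulrA JpowS_mulr.
- by rewrite mulrA JpowS_mulr.
exact: two_J2_span.
Qed.

Lemma two_J4_span x y : sqgens x y ->
  (J ^+ 4 <= <[x * (y * (x * y))]> + (<[y * (x * (y * x))]> + J ^+ 5))%VS.
Proof.
move=> gxy; have [[Jx Jy _] xx yy _] := gxy.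
have J2xy := Jpow2_mul Jx Jy; have J2yx := Jpow2_mul Jy Jx.
have J3a := JpowS_mull Jx J2yx; have J3b := JpowS_mull Jy J2xy.
apply: (two_Jpow_span gxy) => //.
- by rewrite mulrA (Jpow_mul (m := 3) (n := 2)).
- by rewrite mulrA (Jpow_mul (m := 3) (n := 2)).
exact: two_J3_span.
Qed.

Lemma two_J5_span x y : sqgens x y ->
  (J ^+ 5 <= <[x * (y * (x * (y * x)))]> + (<[y * (x * (y * (x * y)))]> + J ^+ 6))%VS.
Proof.
move=> gxy; have [[Jx Jy _] xx yy _] := gxy.
have J3a := JpowS_mull Jx (Jpow2_mul Jy Jx).
have J3b := JpowS_mull Jy (Jpow2_mul Jx Jy).
have J4a := JpowS_mull Jx J3b; have J4b := JpowS_mull Jy J3a.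
apply: (two_Jpow_span gxy) => //.
- by rewrite mulrA (Jpow_mul (m := 3) (n := 3)).
- by rewrite mulrA (Jpow_mul (m := 3) (n := 3)).
exact: two_J4_span.
Qed.

(** Two words span J^3 modulo J^4, so dim J^4 >= 11 - 2 = 9, which is already the dimension of J^4 +
    [annz]. *)
Lemma two_annz_J4 : (annz <= J ^+ 4)%VS /\ \dim (J ^+ 4) = 9%N.
Proof.
have [x [y gxy]] := two_sqgens.
have d11 := leq_trans (dimvS (two_J3_span gxy)) (dim_addline_le _ _).
rewrite dimJ3 ltnS in d11; have d9 := leq_trans d11 (dim_addline_le _ _).
have /eqP defJ4: (J ^+ 4 == J ^+ 4 + annz)%VS by rewrite eqEdim addvSl dimJ4I.
by split; [rewrite defJ4 addvSr | rewrite defJ4].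
Qed.

Let sIJ4 : (annz <= J ^+ 4)%VS. Proof. by case: two_annz_J4. Qed.
Let dimJ4 : \dim (J ^+ 4) = 9%N. Proof. by case: two_annz_J4. Qed.

Let dimJ5 : (7 <= \dim (J ^+ 5))%N.
Proof.
have [x [y gxy]] := two_sqgens.
have d9 := leq_trans (dimvS (two_J4_span gxy)) (dim_addline_le _ _).
by rewrite dimJ4 ltnS in d9; have := leq_trans d9 (dim_addline_le _ _).
Qed.

Let Jz4 : z \in (J ^+ 4)%VS.
Proof. by apply: (subvP sIJ4); rewrite annzP zz. Qed.

(** Since w is a scalar modulo J and z kills J^5, t (z s w) is a multiple of t (z s). *)
Lemma J4_annz_eq0 s : s \in (J ^+ 4)%VS -> t (z * s) = 0 -> s \in annz.
Proof.
move=> Js ts0; rewrite annzP; apply/eqP/(t_nondeg AJ) => w.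
have [k Jw] := J_decomp AJ w; have /(subvP J5_annz) := JpowS_mulr Js Jw.
rewrite annzP => /eqP/(congr1 t); rewrite linear0 => e.
have: t (z * (s * (w - k%:A))) = t (z * s * w) - k * t (z * s) by lin_expand.
by rewrite e ts0 mulr0 subr0.
Qed.

Lemma two_s_annz x y : sqgens x y ->
  x * (y * (x * y)) - y * (x * (y * x)) \in annz.
Proof.
move=> [[Jx Jy _] _ _ _]; apply: J4_annz_eq0.
  by rewrite memvB // !JpowS_mull ?Jpow2_mul.
by rewrite mulrBr linearB /= tzC -!mulrA subrr.
Qed.

(** If the two words of length 4 agreed modulo J^5, both words of length 5 would contain a square
    modulo J^6; then J^5 = J^6 = 0, but dim J^5 >= 7. *)
Lemma two_s_notin x y : sqgens x y ->
  x * (y * (x * y)) - y * (x * (y * x)) \notin (J ^+ 5)%VS.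
Proof.
move=> gxy; have [[Jx Jy _] xx yy _] := gxy; apply/negP => Js.
have J3a := JpowS_mull Jx (Jpow2_mul Jy Jx).
have J3b := JpowS_mull Jy (Jpow2_mul Jx Jy).
set s1 := x * _ in Js *; set s2 := y * _ in Js *.
have xs1: x * s1 \in (J ^+ 6)%VS by rewrite mulrA (Jpow_mul (m := 3) (n := 3)).
have ys2: y * s2 \in (J ^+ 6)%VS by rewrite mulrA (Jpow_mul (m := 3) (n := 3)).
have xs2: x * s2 \in (J ^+ 6)%VS.
  by rewrite -[s2](subKr s1) mulrBr memvB // JpowS_mull.
have ys1: y * s1 \in (J ^+ 6)%VS.
  by rewrite -[s1](subrK s2) mulrDr memvD // JpowS_mull.
have := dimJ5; rewrite (Jpow_stable AJ (n := 5)) ?dimv0 //.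
by rewrite (subv_trans (two_J5_span gxy)) // !subv_add subvv andbT -!memvE xs2.
Qed.

(** As z is in J^4, z J <= J^5. Conversely J^5 is a proper subspace of [annz], which also contains
    xyxy - yxyx, so its dimension is at most 7. *)
Let defJ5 : zJ = (J ^+ 5)%VS.
Proof.
have [x [y gxy]] := two_sqgens.
apply/eqP; rewrite eqEdim; apply/andP; split.
  by apply/subvP => _ /memv_imgP[j Jj ->]; rewrite lfunE; apply: JpowS_mulr.
rewrite dim_zJ -ltnS -[8%N]/(7.+1) -dimI.
rewrite (ltn_leqif (dimv_leqif_sup J5_annz)); apply: contra (two_s_notin gxy).
by move/subvP; apply; apply: two_s_annz.
Qed.

Lemma two_mulz_J6 a : z * a \in (J ^+ 6)%VS -> a \in (J ^+ 2)%VS.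
Proof.
move=> J6a; have sJ6: (J ^+ 6 <= amull z @: (J ^+ 2))%VS.
  rewrite expvSl -defJ5; apply/prodvP => u _ Ju /memv_imgP[j Jj ->].
  rewrite lfunE /= mulrA -zC -mulrA -[z * (u * j)]/((z \*o idfun) (u * j)) -lfunE.
  by rewrite memv_img // Jpow2_mul.
have /memv_imgP[r Jr] := subvP sJ6 _ J6a; rewrite lfunE /= => zar.
rewrite -[a](subrK r) memvD // (subvP annz_J2) // annzP mulrBr zar subrr //.
Qed.

(** Write xyxy - yxyx = k z + z j. Modulo J^6, multiplying by x on the right gives xyxyx and on the
    left -xyxyx, whereas k z x is the same on both sides. *)
Lemma two_xyxyx x y : sqgens x y ->
  exists k, [/\ k != 0,
    k *: (z * x) - x * (y * (x * (y * x))) \in (J ^+ 6)%VS &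
    k *: (z * x) + x * (y * (x * (y * x))) \in (J ^+ 6)%VS].
Proof.
move=> gxy; have [[Jx Jy _] xx yy _] := gxy.
have J3a := JpowS_mull Jx (Jpow2_mul Jy Jx).
have J3b := JpowS_mull Jy (Jpow2_mul Jx Jy).
have [k [j [Jj def_s]]] := annz_decomp (two_s_annz gxy).
have Jzj: z * j \in (J ^+ 5)%VS by rewrite -defJ5 mem_zJ.
have nk: k != 0.
  apply/eqP => k0; case/negP: (two_s_notin gxy).
  by rewrite def_s k0 scale0r add0r.
exists k; split=> //.
  have ->: k *: (z * x) - x * (y * (x * (y * x))) =
      (k *: z + z * j) * x - x * (y * (x * (y * x))) - z * j * x by alg_expand.
  rewrite -def_s; apply: memvB; last exact: JpowS_mulr.
  have ->: (x * (y * (x * y)) - y * (x * (y * x))) * x - x * (y * (x * (y * x)))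
    = - (y * (x * y) * (x * x)) by alg_expand.
  by rewrite memvN (Jpow_mul (m := 3) (n := 3)).
have ->: k *: (z * x) + x * (y * (x * (y * x))) =
    x * (k *: z + z * j) + x * (y * (x * (y * x))) - x * (z * j).
  by rewrite [z * x]zC; alg_expand.
rewrite -def_s; apply: memvB; last exact: JpowS_mull.
have ->: x * (x * (y * (x * y)) - y * (x * (y * x))) + x * (y * (x * (y * x)))
  = x * x * (y * (x * y)) by alg_expand.
by rewrite (Jpow_mul (m := 3) (n := 3)).
Qed.

(** Adding the two congruences of [two_xyxyx] gives 2 k z x in J^6; if 2 were invertible, x would
    lie in J^2. *)
Lemma two_char2 : 1 + 1 = 0 :> F.
Proof.
have [x [y gxy]] := two_sqgens; have [k [nk J1 J2]] := two_xyxyx gxy.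
apply/eqP/negPn/negP => n2; have [gx _ _ _] := gxy.
case/negP: (gens_notin_J2 gx); apply: two_mulz_J6.
have := memvD J1 J2; rewrite addrACA addNr addr0 -scalerDl -mulr2n -mulr_natr.
move=> Jx; rewrite -[z * x](scalerK (mulf_neq0 nk n2)) memvZ //.
Qed.

Let add2 (a : A) : a + a = 0.
Proof. by rewrite -(scale1r a) -scalerDl two_char2 scale0r. Qed.

Let opp2 (a : A) : - a = a.
Proof. by apply/eqP; rewrite eq_sym -addr_eq0 add2. Qed.

Lemma two_xyxyx_notin x y : sqgens x y -> x * (y * (x * (y * x))) \notin (J ^+ 6)%VS.
Proof.
move=> gxy; apply/negP => Jw; have [k [nk J1 _]] := two_xyxyx gxy.
have [gx _ _ _] := gxy; case/negP: (gens_notin_J2 gx); apply: two_mulz_J6.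
by rewrite -[z * x](scalerK nk) memvZ // -[k *: _](subrK (x * (y * (x * (y * x))))) memvD.
Qed.

(** If b is the coefficient of yxy in x x, then x (x x) = (x x) x forces b (xyxy - yxyx) into J^5,
    so b = 0. *)
Lemma two_sqr_J4 x y : sqgens x y -> exists a, x * x - a *: (x * (y * x)) \in (J ^+ 4)%VS.
Proof.
move=> gxy; have [[Jx Jy _] xx yy _] := gxy.
have /memv_addline[a /memv_addline[b]] := subvP (two_J3_span gxy) _ xx.
set r := _ - _ => Jr; suffices b0: b = 0 by exists a; rewrite /r b0 scale0r subr0 in Jr.
have def_xx: x * x = a *: (x * (y * x)) + b *: (y * (x * y)) + r.
  by rewrite addrC /r addrA addrAC !subrK.
apply/eqP/negPn/negP => nb; case/negP: (two_s_notin gxy).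
have xM: x * (x * x) - x * x * x = 0 by rewrite mulrA subrr.
have J3a := JpowS_mull Jx (Jpow2_mul Jy Jx).
rewrite -[_ - _](scalerK nb) memvZ //.
have ->: b *: (x * (y * (x * y)) - y * (x * (y * x))) = (x * (x * x) - x * x * x)
    + a *: (x * y * (x * x) - x * x * (y * x)) + (r * x - x * r).
  rewrite [in X in X + _ + _]def_xx; move: (r) => ?; alg_expand.
rewrite xM add0r; apply: memvD.
  apply: memvZ; apply: memvB; last exact: (Jpow_mul (m := 3) (n := 2) xx (Jpow2_mul Jy Jx)).
  exact: (Jpow_mul (m := 2) (n := 3) (Jpow2_mul Jx Jy) xx).
by apply: memvB; [apply: JpowS_mulr | apply: JpowS_mull].
Qed.

(** Replacing x by x + a y x adds a xyx to its square modulo J^4; the square already being a xyx,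
    the two cancel in characteristic 2. *)
Lemma two_sqgens_J4 : exists x y,
  [/\ sqgens x y, x * x \in (J ^+ 4)%VS & y * y \in (J ^+ 4)%VS].
Proof.
have [x0 [y0 gxy]] := two_sqgens; have [[Jx Jy sJ] xx yy c] := gxy.
have [a Ja] := two_sqr_J4 gxy; have [b Jb] := two_sqr_J4 (sqgensC gxy).
have sq u v k : u \in J -> v \in J -> u * u \in (J ^+ 3)%VS ->
    u * u - k *: (u * (v * u)) \in (J ^+ 4)%VS ->
    (u + k *: (v * u)) * (u + k *: (v * u)) \in (J ^+ 4)%VS.
  move=> Ju Jv J3u Jk.
  have ->: (u + k *: (v * u)) * (u + k *: (v * u)) = (u * u - k *: (u * (v * u)))
    + k *: (u * (v * u) + u * (v * u)) + (k *: (v * (u * u)) + (k * k) *: (v * u * (v * u))).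
    by alg_expand.
  rewrite add2 scaler0 addr0; apply: memvD => //; apply: memvD; apply: memvZ.
    exact: JpowS_mull.
  exact: (Jpow_mul (m := 2) (n := 2) (Jpow2_mul Jv Ju) (Jpow2_mul Jv Ju)).
have xx' := sq x0 y0 a Jx Jy xx Ja; have yy' := sq y0 x0 b Jy Jx yy Jb.
set x := x0 + _ in xx'; set y := y0 + _ in yy'.
have J2yx := Jpow2_mul Jy Jx; have J2xy := Jpow2_mul Jx Jy.
have Jx' : x \in J by rewrite memvD ?memvZ // (J_of_Jpow AJ J2yx).
have Jy' : y \in J by rewrite memvD ?memvZ // (J_of_Jpow AJ J2xy).
have sub4 w : w \in (J ^+ 4)%VS -> w \in (J ^+ 3)%VS.
  by move=> Jw; apply: (Jpow_mem AJ Jw).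
exists x, y; split=> //; split; last 3 first.
- exact: sub4.
- exact: sub4.
- apply: contra c => Jc.
  have ->: x0 * y0 - y0 * x0 = (x * y - y * x)
      - a *: (y0 * x0 * y - y * (y0 * x0)) - b *: (x0 * (x0 * y0) - x0 * y0 * x0).
    by rewrite /x /y; alg_expand.
  apply: memvB; first apply: memvB => //; apply: memvZ; apply: memvB.
  + exact: JpowS_mulr.
  + exact: JpowS_mull.
  + exact: JpowS_mull.
  exact: JpowS_mulr.
split=> //; rewrite (subv_trans sJ) // !subv_add; apply/and3P; split.
- apply/memv_addline; exists 1; apply: (subvP (addvSr _ _)).
  by rewrite scale1r /x opprD addrA subrr add0r memvN memvZ.
- apply: (subvP (addvSr _ _)); apply/memv_addline; exists 1.
  by rewrite scale1r /y opprD addrA subrr add0r memvN memvZ.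
exact: subv_trans (addvSr _ _) (addvSr _ _).
Qed.

(** With coefficients a, b of xyxy and yxyx in x x modulo J^5, x (x x) = (x x) x forces (b - a)
    xyxyx into J^6, so a = b. In characteristic 2, x x is then a (xyxy - yxyx) modulo J^5, and both
    parts are in [annz]. *)
Lemma two_sqr_annz x y : sqgens x y -> x * x \in (J ^+ 4)%VS -> x * x \in annz.
Proof.
move=> gxy J4xx; have [[Jx Jy _] xx yy _] := gxy.
have J3b := JpowS_mull Jy (Jpow2_mul Jx Jy).
have /memv_addline[a /memv_addline[b]] := subvP (two_J4_span gxy) _ J4xx.
set r := _ - _ => Jr.
have def_xx: x * x = a *: (x * (y * (x * y))) + b *: (y * (x * (y * x))) + r.
  by rewrite addrC /r addrA addrAC !subrK.
have xM: x * (x * x) - x * x * x = 0 by rewrite mulrA subrr.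
have ba: b - a = 0.
  apply/eqP/negPn/negP => nba; case/negP: (two_xyxyx_notin gxy).
  rewrite -[x * (y * _)](scalerK nba) memvZ //.
  have ->: (b - a) *: (x * (y * (x * (y * x)))) = (x * (x * x) - x * x * x)
      - a *: (x * x * (y * (x * y))) + b *: (y * (x * y) * (x * x)) - (x * r - r * x).
    by rewrite [in X in X - _ + _ - _]def_xx scalerBl; move: (r) => ?; alg_expand.
  rewrite xM add0r; apply: memvB; last first.
    by apply: memvB; [apply: JpowS_mull | apply: JpowS_mulr].
  apply: memvD; [rewrite memvN|]; apply: memvZ.
    exact: (Jpow_mul (m := 3) (n := 3)).
  exact: (Jpow_mul (m := 3) (n := 3)).
have ->: x * x = a *: (x * (y * (x * y)) - y * (x * (y * x))) + r.
  by rewrite {1}def_xx scalerBr -scalerN opp2 (subr0_eq ba).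
by rewrite memvD ?memvZ ?two_s_annz // (subvP J5_annz).
Qed.

Lemma two_xyx_notin x y : sqgens x y -> x * (y * x) \notin annz.
Proof.
move=> gxy; apply/negP => Ixyx.
have: (J ^+ 4 <= annz)%VS.
  rewrite (subv_trans (two_J4_span gxy)) // !subv_add -!memvE J5_annz andbT.
  rewrite (annz_mull y Ixyx) andbT.
  have -> : x * (y * (x * y)) = x * (y * x) * y by rewrite !mulrA.
  exact: annz_mulr.
by move/dimvS; rewrite dimJ4 dimI.
Qed.

(** Write x x = z g. As x x commutes with x, g x - x g is in [annz]; expanding g in alternating
    words modulo J^4, this kills the coefficient of y and equates those of x y and y x. What remains
    of g y - y g modulo [annz] is k1 (x y - y x). *)
Lemma two_comm_sqr x y : sqgens x y -> x * x \in annz -> y * y \in annz ->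
  exists k, x * x * y - y * (x * x) = k *: (z * (x * y - y * x)).
Proof.
move=> gxy Ixx Iyy; have [[Jx Jy sJ] _ _ nc] := gxy.
have [g def_xx] := annz_mulz Ixx.
have Igx: g * x - x * g \in annz.
  by rewrite annzP mulrBr !mulrA [z * x]zC -[x * z * g]mulrA -def_xx mulrA subrr.
have [k0 Jg] := J_decomp AJ g; have [k1 [k2 [r [Jr def_g]]]] := J_span2 sJ Jg.
have /memv_addline[k3 /memv_addline[k4 Jr3]] := subvP (two_J2_span gxy) r Jr.
have /memv_addline[k5 /memv_addline[k6 Jr4]] := subvP (two_J3_span gxy) _ Jr3.
set r4 := _ - k6 *: _ in Jr4.
have {}def_g: g = k0%:A + k1 *: x + k2 *: y + k3 *: (x * y) + k4 *: (y * x)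
    + k5 *: (x * (y * x)) + k6 *: (y * (x * y)) + r4.
  rewrite -[g](subrK k0%:A) {}def_g /r4.
  by apply: scalar_ext => f; rewrite !(linearD, linearN) /=; ring.
have Is := two_s_annz gxy.
have r4I u : u \in J -> r4 * u - u * r4 \in annz.
  move=> Ju; apply: (subvP J5_annz).
  by apply: memvB; [apply: JpowS_mulr | apply: JpowS_mull].
have E1: k2 *: (y * x - x * y) + (k3 - k4) *: (x * (y * x)) \in annz.
  have ->: k2 *: (y * x - x * y) + (k3 - k4) *: (x * (y * x)) =
      (g * x - x * g) + k3 *: (x * x * y) - k4 *: (y * (x * x))
      - k5 *: (x * y * (x * x) - x * x * (y * x))
      + k6 *: (x * (y * (x * y)) - y * (x * (y * x))) - (r4 * x - x * r4).
    by rewrite def_g scalerBl; move: (r4) => ?; alg_expand.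
  have I1 := annz_mulr y Ixx; have I2 := annz_mull y Ixx.
  have I3 := annz_mull (x * y) Ixx; have I4 := annz_mulr (y * x) Ixx.
  have I5 := r4I x Jx.
  by memv_lin.
have k20: k2 = 0.
  apply/eqP/negPn/negP => nk2; case/negP: nc.
  rewrite -opprB memvN -[y * x - _](scalerK nk2) memvZ //.
  rewrite -[k2 *: _](addrK ((k3 - k4) *: (x * (y * x)))) memvB //.
    exact: (subvP two_annz_J3).
  by rewrite memvZ // JpowS_mull // Jpow2_mul.
have k34: k3 - k4 = 0.
  apply/eqP/negPn/negP => nk; case/negP: (two_xyx_notin gxy).
  rewrite -[x * _](scalerK nk) memvZ //.
  by move: E1; rewrite k20 scale0r add0r.
have {k34}k34 := subr0_eq k34.
exists k1; rewrite def_xx.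
have ->: z * g * y - y * (z * g) = z * (g * y - y * g).
  by rewrite [y * _]mulrA -zC mulrBr !mulrA.
apply/eqP; rewrite scalerAr -subr_eq0 -mulrBr -annzP.
have ->: g * y - y * g - k1 *: (x * y - y * x) = k3 *: (x * (y * y)) - k3 *: (y * y * x)
    + k5 *: (x * (y * (x * y)) - y * (x * (y * x)))
    + k6 *: (y * x * (y * y) - y * y * (x * y)) + (r4 * y - y * r4).
  by rewrite def_g k20 k34; move: (r4) => ?; alg_expand.
have I1 := annz_mulr x Iyy; have I2 := annz_mull x Iyy.
have I3 := annz_mull (y * x) Iyy; have I4 := annz_mulr (x * y) Iyy.
have I5 := r4I y Jy.
by memv_lin.
Qed.

Lemma two_false : False.
Proof.
have [x [y [gxy xx yy]]] := two_sqgens_J4; have gyx := sqgensC gxy.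
have [[Jx Jy sJ] _ _ nc] := gxy.
have Ixx := two_sqr_annz gxy xx; have Iyy := two_sqr_annz gyx yy.
have [k Ek] := two_comm_sqr gxy Ixx Iyy; have [l El] := two_comm_sqr gyx Iyy Ixx.
(* The commutator of x with x y + y x is x x y - y x x = k z (x y - y x), which is also the
   commutator of x with k z y; similarly for y and l z x. *)
pose p := x * y + y * x - k *: (z * y) - l *: (z * x).
have px: p * x = x * p.
  apply/esym/eqP; rewrite -subr_eq0; apply/eqP.
  have ->: x * p - p * x = (x * x * y - y * (x * x))
    - k *: (x * z * y - z * y * x) - l *: (x * z * x - z * x * x) by rewrite /p; alg_expand.
  by rewrite Ek -!zC subrr scaler0 subr0 -!mulrA -mulrBr subrr.
have py: p * y = y * p.
  apply/esym/eqP; rewrite -subr_eq0; apply/eqP.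
  have ->: y * p - p * y = (y * y * x - x * (y * y))
    - l *: (y * z * x - z * x * y) - k *: (y * z * y - z * y * y) by rewrite /p; alg_expand.
  by rewrite El -!zC subrr scaler0 subr0 -!mulrA -mulrBr subrr.
have Zp: p \in Z := center_gen2 AJ sJ px py.
have Jzj j : z * j \in J by apply: (subvP annz_J); apply: mulz_annz.
have Jp: p \in J.
  have J1 := J_mull AJ x Jy; have J2 := J_mull AJ y Jx.
  have J3 := Jzj x; have J4 := Jzj y; rewrite /p; memv_lin.
have Ip := center_annz Zp Jp.
case/negP: nc; apply: (subvP two_annz_J3).
(* In characteristic 2 the commutator and x y + y x coincide. *)
have ->: x * y - y * x = p + k *: (z * y) + l *: (z * x).
  rewrite opp2 /p; apply: scalar_ext => f; rewrite !(linearD, linearN) /=; ring.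
have I1 := mulz_annz x; have I2 := mulz_annz y; by memv_lin.
Qed.

End TwoGenerators.

End Sixteen.

(** * The radical of a local algebra and the socle of its center *)

Section LocalAlgebra.

Local Open Scope ring_scope.

Variables (F : closedFieldType) (A : falgType F).
Implicit Types (M N P Q : {vspace A}).

Lemma left_idealP N : left_ideal N -> forall a b, b \in N -> a * b \in N.
Proof. by move=> /prodvP Nl a b Nb; rewrite Nl ?memvf. Qed.

(** Used with M = A to get maximal left ideals, and with M a power of the radical to get a maximal
    left ideal inside it. *)
Lemma max_left_ideal M N : left_ideal N -> (N <= M)%VS -> N != M ->
  exists P, [/\ left_ideal P, (N <= P)%VS, (P <= M)%VS, P != M
    & forall Q, left_ideal Q -> (P <= Q)%VS -> (Q <= M)%VS -> Q = P \/ Q = M].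
Proof.
have [k] := ubnP (\dim M - \dim N); elim: k N => // k IHk N lt_d lN sNM neNM.
case: (classic (exists Q, [/\ left_ideal Q, (N <= Q)%VS, (Q <= M)%VS, Q != N
    & Q != M])) => [[Q [lQ sNQ sQM neQN neQM]]|noQ].
  have ltNQ: (\dim N < \dim Q)%N.
    by rewrite (ltn_leqif (dimv_leqif_eq sNQ)) eq_sym.
  have leQM := dimvS sQM.
  have [|P [lP sQP sPM nePM maxP]] := IHk Q _ lQ sQM neQM; first by lia.
  by exists P; split=> //; apply: subv_trans sQP.
exists N; split=> // Q lQ sNQ sQM; have [->|neQN] := eqVneq Q N; first by left.
have [->|neQM] := eqVneq Q M; first by right.
by case: noQ; exists Q.
Qed.

(** Left multiplication by y is injective, hence surjective in finite dimension. *)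
Lemma mulr1_comm (x y : A) : x * y = 1 -> y * x = 1.
Proof.
move=> xy; have ker0: lker (amull y) == 0%VS.
  apply/lker0P => u v; rewrite !lfunE /= => /(congr1 ( *%R x)).
  by rewrite !mulrA xy !mul1r.
have /memv_imgP[w _]: 1 \in limg (amull y) by rewrite lker0_limgf // memvf.
rewrite lfunE /= => yw; suffices ->: x = w by [].
by rewrite -[x]mulr1 yw mulrA xy mul1r.
Qed.

Hypothesis locA : local_algebra A.

Lemma jacobson_unit (j : A) : jacobson j -> exists c, c * (1 + j) = 1.
Proof.
move=> Jj; pose L := ({:A} * <[1 + j]>)%VS.
have lL: left_ideal L by rewrite /left_ideal prodvA prodvSl ?subvf.
have [defL|neL] := eqVneq L {:A}%VS.
  have: 1 \in L by rewrite defL memvf.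
  by case/memv_cosetP => c _ c1; exists c.
have [M [lM sLM _ neM maxM]] := max_left_ideal lL (subvf L) neL.
have Mj: j \in M.
  by apply: Jj; split=> // Q lQ sMQ; apply: maxM; rewrite ?subvf.
have M1j: 1 + j \in M.
  apply: (subvP sLM); rewrite -[1 + j]mul1r memv_mul ?memvf // memv_line //.
case/eqP: neM; apply/eqP; rewrite eqEsubv subvf; apply/subvP => a _.
by rewrite -[a]mulr1 left_idealP // -(addrK j 1) memvB.
Qed.

(** Any maximal left ideal M serves: an element outside M is outside the radical, hence invertible
    modulo the radical, and 1 + j is left invertible for j in the radical. *)
Lemma local_radical : exists M,
  [/\ left_ideal M, 1 \notin M & forall a, a \notin M -> exists b, b * a = 1].
Proof.
have l0: left_ideal (0 : {vspace A}) by rewrite /left_ideal prodv0 sub0v.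
have ne0: 0%VS != {:A}%VS.
  by apply: contraNneq (vspace1_neq0 A) => A0; rewrite -subv0 A0 subvf.
have [M [lM _ _ neM maxM]] := max_left_ideal l0 (sub0v _) ne0.
have mM: maximal_left_ideal M.
  by split=> // Q lQ sMQ; apply: maxM; rewrite ?subvf.
exists M; split=> //.
  apply: contra neM => M1; rewrite eqEsubv subvf; apply/subvP => a _.
  by rewrite -[a]mulr1 left_idealP.
move=> a Ma; have [_ inv] := locA.
have [|b [_ Jba]] := inv a; first by move=> /(_ M mM); apply/negP.
have [c] := jacobson_unit Jba; rewrite addrC subrK mulrA => ca.
by exists (c * b).
Qed.

(* A product of elements [a - k] with [a - k] not in [M] is left invertible,
   while a suitable one vanishes, being a multiple of a polynomial in [a]. *)
Lemma scalar_mod M : (forall a, a \notin M -> exists b, b * a = 1) ->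
  forall a, exists k, a - k%:A \in M.
Proof.
move=> invM a; pose n := \dim {:A}.
pose ev (c : 'rV[F]_n.+1) := \sum_i c 0 i *: a ^+ i.
have ev_linear : linear ev.
  move=> k c d; rewrite /ev scaler_sumr -big_split; apply: eq_bigr => i _ /=.
  by rewrite !mxE scalerDl scalerA.
pose evL : {linear 'rV[F]_n.+1 -> A} :=
  HB.pack ev (GRing.isLinear.Build _ _ _ _ ev ev_linear).
have [c kc nzc]: exists2 c, c \in lker (linfun evL)
    & c \notin (0 : {vspace 'rV[F]_n.+1})%VS.
  apply: memv_dim_lt; rewrite dimv0.
  have := limg_ker_dim (linfun evL) fullv; rewrite capfv dimvf dim_matrix [(1 * _)%R]mul1n.
  have := dimvS (subvf (limg (linfun evL))); rewrite -/n; lia.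
pose p : {poly F} := \poly_(i < n.+1) c 0 (inord i).
have pa : horner_alg a p = 0.
  rewrite /p poly_def linear_sum /= -[RHS](eqP (etrans (esym (memv_ker _ _)) kc)).
  rewrite lfunE /=; apply: eq_bigr => i _.
  by rewrite linearZ /= rmorphXn /= horner_algX inord_val mulr_algl.
have nzp : p != 0.
  apply: contra nzc => /eqP p0; rewrite memv0; apply/eqP/rowP => i.
  have := coef_poly n.+1 (fun l => c 0 (inord l)) i.
  by rewrite -/p p0 coef0 ltn_ord inord_val mxE.
have [r def_p] := closed_field_poly_normal p.
have [/hasP[k _ Mk]|/hasPn nMr] := boolP (has (fun k => a - k%:A \in M) r).
  by exists k.
have [b ba]: exists b, b * horner_alg a (\prod_(k <- r) ('X - k%:P)) = 1.
  elim: r nMr {def_p} => [|k r IHr] nMr.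
    by exists 1; rewrite big_nil rmorph1 mulr1.
  have [|b ba] := IHr; first by move=> l rl; rewrite nMr // inE rl orbT.
  have [c' ck] := invM _ (nMr k (mem_head k r)); exists (b * c').
  rewrite big_cons rmorphM rmorphB /= horner_algX horner_algC.
  by rewrite -mulrA [c' * _]mulrA ck mul1r.
have: b * horner_alg a p = lead_coef p *: 1.
  by rewrite [in LHS]def_p linearZ /= mulr_algl -scalerAr ba.
rewrite pa mulr0 => /esym/eqP; rewrite scaler_eq0 oner_eq0 orbF.
by rewrite lead_coef_eq0 (negPf nzp).
Qed.

(** Nakayama: let P be a maximal left ideal inside M^(n+1). If j m were outside P, then m = a j m +
    w with w in P, and inverting 1 - a j gives m in P. So M^(n+2) <= P, and the dimensions drop
    strictly. *)
Lemma local_radical_nilpotent M : left_ideal M -> 1 \notin M ->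
  (forall a, a \notin M -> exists b, b * a = 1) -> exists n, (M ^+ n)%VS = 0%VS.
Proof.
move=> lM nM1 invM; have lMn n: left_ideal (M ^+ n.+1)%VS.
  by rewrite /left_ideal expvSl prodvA prodvSl.
have shrink n : (M ^+ n.+1)%VS != 0%VS -> (\dim (M ^+ n.+2) < \dim (M ^+ n.+1))%N.
  move=> nzMn; have l0: left_ideal (0 : {vspace A}) by rewrite /left_ideal prodv0 sub0v.
  have [|P [lP _ sPM nePM maxP]] := max_left_ideal l0 (sub0v (M ^+ n.+1)%VS).
    by rewrite eq_sym.
  apply: leq_ltn_trans (_ : \dim P < _)%N; last first.
    by rewrite (ltn_leqif (dimv_leqif_eq sPM)).
  apply/dimvS; rewrite expvSl; apply/prodvP => j m Mj Mm; apply/negPn/negP => nPjm.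
  pose Q := ({:A} * <[j * m]> + P)%VS.
  have Qjm: j * m \in Q.
    rewrite (subvP (addvSl _ _)) //; apply/memv_cosetP.
    by exists 1; rewrite ?memvf ?mul1r.
  have lQ: left_ideal Q.
    rewrite /left_ideal; apply/prodvP => u _ _ /memv_addP[v Lv [w Pw ->]].
    rewrite mulrDr; apply: memv_add; last exact: left_idealP.
    case/memv_cosetP: Lv => v' _ ->; apply/memv_cosetP.
    by exists (u * v'); rewrite ?memvf ?mulrA.
  have sQM: (Q <= M ^+ n.+1)%VS.
    rewrite subv_add sPM andbT; apply/prodvP => u _ _ /vlineP[k ->].
    by rewrite -scalerAr memvZ // !left_idealP.
  have [defQ|defQ] := maxP Q lQ (addvSr _ _) sQM; first by rewrite -defQ Qjm in nPjm.
  have: m \in Q by rewrite defQ.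
  case/memv_addP=> _ /memv_cosetP[a _ ->] [w Pw def_m].
  have [|b b1] := invM (1 - a * j).
    apply: contra nM1 => M1; rewrite -(subrK (a * j) 1) memvD // left_idealP //.
  case/negP: nPjm; rewrite left_idealP // -[m]mul1r -b1 -mulrA left_idealP //.
  by rewrite mulrBl mul1r {1}def_m mulrA addrAC subrr add0r.
have [n0] : exists n, (\dim (M ^+ n.+1) = 0)%N.
  suffices dimM n : (\dim (M ^+ n.+1) <= \dim {:A} - n)%N.
    by exists (\dim {:A}); apply/eqP; rewrite -leqn0 -[X in (_ <= X)%N](subnn (\dim {:A})).
  elim: n => [|n IHn]; first by rewrite subn0 dimvS ?subvf.
  have [Mn0|/shrink] := eqVneq (M ^+ n.+1)%VS 0%VS; last by dim_lia.
  by rewrite expvSr Mn0 prod0v dimv0.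
by move/eqP; rewrite dimv_eq0 => /eqP; exists n0.+1.
Qed.

Lemma local_sym_local : symmetric_algebra A ->
  exists (t : {scalar A}) (J : {vspace A}), sym_local t J.
Proof.
case=> beta [nd assoc]; have [t t1]: exists t : {scalar A}, forall a, t a = beta a 1.
  by exists (applyr beta 1).
exists t; have tE a b : t (a * b) = beta a b by rewrite t1 assoc mulr1.
have betaC a b : beta a b = beta b a by rewrite hermC expr0 mul1r.
have [M [lM M1 invM]] := local_radical; exists M; split.
- by move=> a b; rewrite !tE betaC.
- move=> a a0; apply/eqP; rewrite -memv0 -(eqP nd); apply/mem_orthovP => b _.
  by rewrite -tE a0.
- apply/and3P; split; rewrite ?subvf //; apply/prodvP => a b Ma _.
  (* From c a b = 1 follows b c a = 1, which lies in M together with a. *)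
  apply/negPn/negP => /invM[c]; rewrite mulrA => /mulr1_comm.
  by rewrite mulrA => bca; case/negP: M1; rewrite -bca left_idealP.
- apply/eqP; rewrite eqEsubv subvf; apply/subvP => a _.
  by have [k Mk] := scalar_mod invM a; apply/memv_addline; exists k.
exact: local_radical_nilpotent.
Qed.

(** * The socle of the center *)

Section Socle.

Variables (t : {scalar A}) (J : {vspace A}).
Hypothesis AJ : sym_local t J.

Local Notation Z := 'Z({:A})%VS.

(* The annihilator of [J(Z(A))] in [Z(A)]: by nondegeneracy, [x w = 0] for all
   [w] in [Z(A) :&: J] iff [x] is orthogonal to the ideal they generate. *)
Definition socZ : {vspace A} := (Z :&: perp t ((Z :&: J) * {:A}))%VS.

Lemma socZP x :
  reflect (x \in Z /\ forall w, w \in Z -> w \in J -> x * w = 0) (x \in socZ).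
Proof.
apply: (iffP memv_capP) => [[Zx /perpP x0]|[Zx x0]]; split=> //.
  move=> w Zw Jw; apply: (t_nondeg AJ) => a.
  by rewrite -mulrA x0 // memv_mul ?memvf // memv_cap Zw.
apply/perpP => b; apply: (t_prod0 AJ) => w a /memv_capP[Zw Jw] _.
by rewrite mulrA x0 // mul0r linear0.
Qed.

Lemma memZM a b : a \in Z -> b \in Z -> a * b \in Z.
Proof.
move=> /centerP aC /centerP bC; apply/centerP => c.
by rewrite -mulrA bC mulrA aC mulrA.
Qed.

(** By simplicity (Z :&: J) I is 0 or I; in the second case I lies in all powers of J and
    vanishes. *)
Lemma simple_ideal_socZ (I : {vspace A}) : simple_ideal_of Z I -> (I <= socZ)%VS.
Proof.
case=> /and3P[sIZ /prodvP ZI /prodvP IZ] nzI minI.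
pose N := ((Z :&: J) * I)%VS.
have sNI: (N <= I)%VS by apply/prodvP => w i /memv_capP[Zw _] Ii; apply: ZI.
have idN: ideal_of Z N.
  apply/and3P; split; first exact: subv_trans sNI sIZ.
    rewrite /N prodvA prodvSl //; apply/prodvP => a w Za /memv_capP[Zw Jw].
    by rewrite memv_cap memZM // (J_mull AJ).
  by rewrite /N -prodvA prodvSr //; apply/prodvP.
have [N0|defI] := minI N idN sNI.
  apply/subvP => i Ii; have Zi := subvP sIZ i Ii; apply/socZP; split=> // w Zw Jw.
  have: w * i \in N by rewrite memv_mul // memv_cap Zw.
  by rewrite N0 memv0 => /eqP wi; rewrite (centerP i Zi).
case: AJ => _ _ _ _ [n Jn0]; case/eqP: nzI; apply/eqP; rewrite -subv0.
suffices sIJ k: (I <= J ^+ k.+1)%VS.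
  by apply: subv_trans (sIJ n) _; rewrite expvSr Jn0 prod0v subvv.
elim: k => [|k IHk]; rewrite -defI.
  by rewrite expv1; apply/prodvP => w i /memv_capP[_ Jw] _; apply: (J_mulr AJ).
by rewrite expvSl; apply: subv_trans (prodvSl _ (capvSr _ _)) (prodvSr _ IHk).
Qed.

(** For the converse, a nonzero x in [socZ] spans a simple ideal by itself, since central elements
    act on it by scalars. *)
Lemma in_socP x : in_soc Z x <-> x \in socZ.
Proof.
split=> [[s [simp_s]]|Sx].
  apply/subvP; rewrite big_seq; apply: (big_ind (fun U => (U <= socZ)%VS)).
  - exact: sub0v.
  - by move=> U V sU sV; rewrite subv_add sU.
  by move=> I /simp_s/simple_ideal_socZ.
have [->|nzx] := eqVneq x 0; first by exists [::]; split=> //; rewrite mem0v.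
have [Zx x0] := socZP x Sx.
exists [:: <[x]>%VS]; split; last by rewrite big_seq1 memv_line.
have Zline a : a \in Z -> a * x \in <[x]>%VS.
  move=> Za; have [k Jk] := J_decomp AJ a; apply/vlineP; exists k.
  have: x * (a - k%:A) = 0.
    by apply: x0 => //; rewrite memvB // memvZ // memv1Z.
  rewrite mulrBr -scalerAr mulr1 (centerP x Zx) => /eqP.
  by rewrite subr_eq0 => /eqP.
move=> I; rewrite inE => /eqP->; split.
- apply/and3P; split; first by rewrite -memvE.
    by apply/prodvP => a _ Za /vlineP[k ->]; rewrite -scalerAr memvZ ?Zline.
  apply/prodvP => _ a /vlineP[k ->] Za.
  by rewrite -scalerAl memvZ // (centerP x Zx) Zline.
- by rewrite -dimv_eq0 dim_vline nzx.
move=> N _ sNx; have [N0|nzN] := eqVneq N 0%VS; [by left | right].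
apply/eqP; rewrite eqEdim sNx dim_vline nzx lt0n dimv_eq0 //.
Qed.

Lemma closed_quad (b c : F) : exists k, k * k + b * k + c = 0.
Proof.
have [k Ek] := @solve_monicpoly F 2 (fun i => if i == 0%N then - c else - b) isT.
exists k; move: Ek; rewrite !big_ord_recl big_ord0 /= expr0 mulr1 addr0 expr1 expr2.
by move=> ->; ring.
Qed.

Lemma socZ_comm x a b : (\dim {:A} <= 16)%N -> x \in socZ -> x * (a * b - b * a) = 0.
Proof.
move=> dimA Sx; have [Zx x0] := socZP x Sx; apply/eqP/negPn/negP => nz.
have ncA : ~ commutative_alg A.
  by move=> cA; case/negP: nz; rewrite (cA a b) subrr mulr0.
have nzx: x != 0 by apply: contraNneq nz => ->; rewrite mul0r.
have [s Ss s0]: exists2 s, s \in perp t J & s \notin (0 : {vspace A})%VS.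
  by apply: memv_dim_lt; rewrite dimv0 (dim_soc AJ).
have Js: s \in J.
  have := subvP (soc_sub_Jpow AJ (isT : 0 < 2)%N (nc_J2 AJ ncA)) s Ss.
  exact: (J_of_Jpow AJ).
have Zs: s \in Z.
  have sJ2: (J ^+ 2 <= J)%VS by rewrite -{2}[J]expv1 (Jpow_sub AJ).
  by apply: (subvP (soc2_center AJ)); apply: (subvP (sub_perp t sJ2)).
(* If k is the scalar part of x, a nonzero s in the socle satisfies x s = 0, being in Z and J, and
   (x - k) s = 0; hence k s = 0. *)
have Jx: x \in J.
  have [k Jk] := J_decomp AJ x; suffices k0: k = 0 by rewrite k0 scale0r subr0 in Jk.
  have Ss1: s \in perp t (J ^+ 1) by rewrite expv1.
  have Jk1: x - k%:A \in (J ^+ 1)%VS by rewrite expv1.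
  have := perp_Jpow_mull AJ Ss1 Jk1; rewrite mulrBl x0 // -scalerAl mul1r sub0r.
  move/eqP; rewrite oppr_eq0 scaler_eq0 => /orP[/eqP//|/eqP s00].
  by case/negP: s0; rewrite s00 mem0v.
have ncx: exists a b, x * (a * b - b * a) != 0 by exists a, b.
have [d5|d4] := dim_J2_cases AJ Zx nzx Jx x0 ncx dimA.
  exact: (two_false AJ Jx x0 ncx dimA d5 closed_quad).
exact: (three_false AJ Jx x0 ncx dimA d4).
Qed.

Lemma socZ_ideal : (\dim {:A} <= 16)%N -> ideal_of {:A} socZ.
Proof.
move=> dimA; have SA x a : x \in socZ -> x * a \in socZ.
  move=> Sx; have [Zx x0] := socZP x Sx; have /centerP xC := Zx.
  apply/socZP; split=> [|w Zw Jw].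
    (* Centrality of x a means x (a b - b a) = 0 for all b. *)
    apply/centerP => b; apply/eqP; rewrite -subr_eq0 [b * _]mulrA -xC -!mulrA -mulrBr.
    by rewrite socZ_comm.
  by rewrite -mulrA -(centerP w Zw) mulrA x0 // mul0r.
apply/and3P; split; first exact: subvf.
  apply/prodvP => a x _ Sx; have [Zx _] := socZP x Sx.
  by rewrite -(centerP x Zx) SA.
by apply/prodvP => x a Sx _; apply: SA.
Qed.

End Socle.

End LocalAlgebra.

Theorem theorem4p12 (F : closedFieldType) (A : falgType F) :
  symmetric_algebra A -> local_algebra A -> \dim {:A}%VS <= 16 ->
  exists S : {vspace A},
    (forall x : A, in_soc 'Z({:A})%VS x <-> x \in S) /\ ideal_of {:A}%VS S.
Proof.
move=> symA locA dimA; have [t [J AJ]] := local_sym_local locA symA.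
exists (socZ t J); split; first exact: in_socP.
exact: socZ_ideal.
Qed.
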